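(* Let $A\in\mathcal{H}(d)$ be a $d\times d$ complex Hermitian matrix and let $\mathcal{X},\mathcal{Y}\subset\mathbb{C}^d$ be $k$-dimensional subspaces such that $\mathcal{X}$ is $A$-invariant. Let $U\in\mathcal{U}(d)$ be a direct rotation of $\mathcal{X}$ onto $\mathcal{Y}$ and let $\Theta=\Theta(\mathcal{X},\mathcal{Y})\in[0,\pi/2]^k$ be the principal angles (arranged non-increasingly). Given a $d\times k$ isometry $X$ with range $\mathcal{X}$, let $Y_r=UX$. Then $$ s(X^*AX-Y_r^*AY_r)\prec_w \Theta(\mathcal{X},\mathcal{Y})^2\,\mathrm{Spr}^+(A), $$ where submajorization and entrywise products between vectors of possibly different lengths are interpreted by padding with zeros on the right, and $\Theta^2$ is the entrywise square.
   Context: For a matrix $Z$, $s(Z)$ denotes the vector of singular values counting multiplicities arranged non-increasingly; for Hermitian $A$, $\lambda(A)=(\lambda_1(A)\ge\dots\ge\lambda_d(A))$. For $x,y\in\mathbb{R}^k$, $x\prec_w y$ means $\sum_{i=1}^r x_i^\downarrow\le\sum_{i=1}^r y_i^\downarrow$ for all $r$, where $x^\downarrow$ is the non-increasing rearrangement; for non-negative vectors of different lengths, pad the shorter one with zeros. Spectral spread: $h=\lfloor d/2\rfloor$, $\mathrm{Spr}^+(A)=(\lambda_j(A)-\lambda_{d-j+1}(A))_{j=1}^h$. Principal angles: with $d\times k$ isometries $X,Y$ of ranges $\mathcal{X},\mathcal{Y}$, $\Theta(\mathcal{X},\mathcal{Y})=(\theta_j)_{j=1}^k$ with $\cos\theta_j=s_{k-j+1}(X^*Y)$.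 Direct rotation: let $\mathcal{G}=[(\mathcal{X}\cap\mathcal{Y})\oplus(\mathcal{X}\cap\mathcal{Y}^\perp)\oplus(\mathcal{X}^\perp\cap\mathcal{Y})\oplus(\mathcal{X}^\perp\cap\mathcal{Y}^\perp)]^\perp$, $\mathcal{S}_1=(\mathcal{X}\cap\mathcal{Y}^\perp)\oplus(\mathcal{X}\cap\mathcal{G})$, $\mathcal{S}_2=(\mathcal{X}^\perp\cap\mathcal{Y})\oplus(\mathcal{X}^\perp\cap\mathcal{G})$, $\mathcal{S}_3=(\mathcal{X}^\perp\cap\mathcal{Y})\oplus(\mathcal{Y}\cap\mathcal{G})$, $\Theta'=\Theta(\mathcal{S}_1,\mathcal{S}_3)$, $C=\mathrm{diag}(\cos\Theta')$, $S=\mathrm{diag}(\sin\Theta')$. A unitary $U$ is a direct rotation from $\mathcal{X}$ onto $\mathcal{Y}$ if in some orthonormal basis of $\mathbb{C}^d$ obtained by juxtaposing orthonormal bases of $\mathcal{X}\cap\mathcal{Y}$, $\mathcal{S}_1$, $\mathcal{S}_2$, $\mathcal{X}^\perp\cap\mathcal{Y}^\perp$ it has block form $\begin{pmatrix}I&0&0&0\\0&C&-S&0\\0&S&C&0\\0&0&0&I\end{pmatrix}$. *)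

(* Defs.v *)
(* MathComp + MathComp-Analysis (for acos/cos/sin on a realType)
   + real_closed's complex numbers R[i]. *)
From HB Require Import structures.
From mathcomp Require Import all_boot all_order all_algebra.
From mathcomp Require Import reals trigo.
From mathcomp.real_closed Require Import complex.

Set Implicit Arguments.
Unset Strict Implicit.
Unset Printing Implicit Defensive.

Import Order.TTheory GRing.Theory Num.Theory.
Local Open Scope ring_scope.
Local Open Scope sesquilinear_scope.

Section Defs.
Variable R : realType.
Local Notation C := (R[i]).

(* lambda(A): the eigenvalues of A (roots of the characteristic polynomial,
   counted with multiplicity), arranged non-increasingly.  For Hermitian A the
   eigenvalues are real; we record their real parts. *)
Definition eigvals n (A : 'M[C]_n) : seq R :=
  sort (fun x y : R => y <= x)
    [seq complex.Re z | z <- sval (closed_field_poly_normal (char_poly A))].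

(* s(Z): singular values of Z (square roots of the eigenvalues of Z^* Z),
   counting multiplicities, arranged non-increasingly. *)
Definition svals p q (Z : 'M[C]_(p, q)) : seq R :=
  [seq Num.sqrt x | x <- eigvals (Z ^t* *m Z)].

(* A d x k matrix X is an isometry: X^* X = I_k. *)
Definition is_isometry d k (X : 'M[C]_(d, k)) : Prop := X ^t* \is unitarymx.

(* Subspaces of C^d are represented (mxalgebra style) as row spaces of
   d x d matrices; vectors of C^d are written as rows.
   mx_range X == the column space of X, as a row space. *)
Definition mx_range d k (X : 'M[C]_(d, k)) : 'M[C]_(k, d) := X ^T.

(* Orthogonal complement w.r.t. the standard Hermitian inner product. *)
Definition perp d (S : 'M[C]_d) : 'M[C]_d := kermx (S ^t*).

(* S is A-invariant: A S <= S (with column vectors v in S, A v in S). *)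
Definition mx_invariant d (A S : 'M[C]_d) : bool := (S *m A ^T <= S)%MS.

(* B is (the juxtaposition of) an orthonormal basis of the subspace S. *)
Definition is_onb d n (B : 'M[C]_(d, n)) (S : 'M[C]_d) : Prop :=
  is_isometry B /\ (mx_range B == S)%MS.

(* Principal angles Theta(mx_range X, mx_range Y) for d x k isometries X, Y:
   cos theta_j = s_{k-j+1}(X^* Y), arranged non-increasingly. *)
Definition pangles d k (X Y : 'M[C]_(d, k)) : seq R :=
  [seq acos s | s <- rev (svals (X ^t* *m Y))].

(* Spr^+(A) = (lambda_j(A) - lambda_{d-j+1}(A))_{j=1}^{floor(d/2)} *)
Definition sprplus d (A : 'M[C]_d) : seq R :=
  let l := eigvals A in
  [seq nth 0 l j - nth 0 l (d.-1 - j)%N | j <- iota 0 d./2].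

(* entrywise product of two vectors, the shorter padded with zeros
   (the padded entries are 0, so we truncate; weak majorization below pads
   again with zeros anyway). *)
Definition padmul (s t : seq R) : seq R := [seq x.1 * x.2 | x <- zip s t].

(* x <_w y  (weak submajorization), padding the shorter vector with zeros. *)
Definition wmaj (x y : seq R) : Prop :=
  let n := maxn (size x) (size y) in
  let x' := sort (fun a b : R => b <= a) (x ++ nseq (n - size x) 0) in
  let y' := sort (fun a b : R => b <= a) (y ++ nseq (n - size y) 0) in
  forall r, (r <= n)%N ->
    \sum_(i < r) nth 0 x' i <= \sum_(i < r) nth 0 y' i.

(* The block matrix  diag(I_n1, [[Cm, -Sm],[Sm, Cm]], I_n4). *)
Definition rot_block n1 m n4 (Cm Sm : 'M[C]_m) : 'M[C]_(n1 + m + m + n4) :=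
  block_mx
    (block_mx (block_mx (1%:M : 'M[C]_n1) 0 0 Cm) (col_mx 0 (- Sm))
              (row_mx 0 Sm) Cm)
    0 0 (1%:M : 'M[C]_n4).

(* U is a direct rotation from X = mx_range SX onto Y = mx_range SY. *)
Definition direct_rotation d (SX SY U : 'M[C]_d) : Prop :=
  let XiY   := (SX :&: SY)%MS in
  let XiYp  := (SX :&: perp SY)%MS in
  let XpiY  := (perp SX :&: SY)%MS in
  let XpiYp := (perp SX :&: perp SY)%MS in
  let G     := perp (XiY + XiYp + XpiY + XpiYp)%MS in
  let S1    := (XiYp + (SX :&: G))%MS in
  let S2    := (XpiY + (perp SX :&: G))%MS in
  let S3    := (XpiY + (SY :&: G))%MS in
  exists (n1 m n4 : nat) (B1 : 'M[C]_(d, n1)) (B2 B3 : 'M[C]_(d, m))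
         (B4 : 'M[C]_(d, n4)) (P3 : 'M[C]_(d, m)),
    let W := row_mx (row_mx (row_mx B1 B2) B3) B4 in
    (* Theta' = Theta(S1, S3), computed from the orthonormal bases B2 of S1
       and P3 of S3 *)
    let th := pangles B2 P3 in
    let Cm := diag_mx (\row_(j < m) ((cos (nth 0 th j))%:C)%C) in
    let Sm := diag_mx (\row_(j < m) ((sin (nth 0 th j))%:C)%C) in
    [/\ is_onb B1 XiY, is_onb B2 S1, is_onb B3 S2 & is_onb B4 XpiYp] /\
    [/\ is_onb P3 S3, (n1 + m + m + n4)%N = d, is_isometry W &
        U *m W = W *m rot_block n1 n4 Cm Sm].

End Defs.

(* Main.v *)
(* Let [P] be the projection onto the range of [X], [Q = 1 - P].  In the basis of
   the direct rotation, [U = U(1)] for the one-parameter group [U(t) = exp(tK)],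
   [K = E - E^*], where [E = Q E P] has the rotation angles [th_j] as its singular
   values.  Put [A(t) = U(t)^* A U(t)], so that [A' = [A, K]].  By Ky Fan, the sum of
   the [r] largest singular values of the difference is [phi(1) - phi(0)] with
   [phi(t) = Re tr(Z A(t))] for a Hermitian partial isometry [Z = P Z P] of rank at
   most [r].  Then [phi' = 2 Re tr(E Z A(t))].  Writing [E] as a positive combination
   of partial isometries [J_j] of rank [j], the pieces [chi_j(t) = Re tr(J_j Z A(t))]
   vanish at [0], since [X] spans an invariant subspace, and their derivatives are
   combinations of the numbers [Re tr(A(t) (V J_l^* - J_l^* V))], [V = J_j Z], each at
   most the sum of the [min(r, j, l)] largest spreads of [A].  Two applications of the
   mean value inequality and a layer-cake summation give the bound
   [sum_(i < r) th_i^2 Spr_i(A)]. *)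

Require Import Defs.
From mathcomp Require Import all_boot all_order all_fingroup all_algebra.
From mathcomp Require Import boolp functions reals topology normedtype derive realfun trigo.
From mathcomp.real_closed Require Import complex.
From mathcomp Require Import zify ring lra.

Set Implicit Arguments.
Unset Strict Implicit.
Unset Printing Implicit Defensive.

Import Order.TTheory GRing.Theory Num.Theory numFieldNormedType.Exports.
Local Open Scope ring_scope.
Local Open Scope sesquilinear_scope.

(** * Contractions and partial isometries *)

Section PositiveSemidefinite.
Variable C : numClosedFieldType.

Lemma adjmxM m n p (A : 'M[C]_(m, n)) (B : 'M[C]_(n, p)) :
  (A *m B)^t* = B^t* *m A^t*.
Proof. by rewrite trmx_mul map_mxM. Qed.

Lemma adjmxD m n (A B : 'M[C]_(m, n)) : (A + B)^t* = A^t* + B^t*.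
Proof. by rewrite linearD map_mxD. Qed.

Lemma adjmxN m n (A : 'M[C]_(m, n)) : (- A)^t* = - A^t*.
Proof. by rewrite linearN map_mxN. Qed.

Lemma adjmxB m n (A B : 'M[C]_(m, n)) : (A - B)^t* = A^t* - B^t*.
Proof. by rewrite adjmxD adjmxN. Qed.

Lemma adjmx1 n : (1%:M : 'M[C]_n)^t* = 1%:M.
Proof. by rewrite trmx1 map_mx1. Qed.

Lemma adjmxZ m n (a : C) (A : 'M[C]_(m, n)) : (a *: A)^t* = a^* *: A^t*.
Proof. by rewrite linearZ map_mxZ. Qed.

Lemma adjmx_sum m n I (s : seq I) (F : I -> 'M[C]_(m, n)) :
  (\sum_(i <- s) F i)^t* = \sum_(i <- s) (F i)^t*.
Proof.
apply: (big_morph (fun A : 'M[C]_(m, n) => A^t*)) => [A B|]; first exact: adjmxD.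
by rewrite trmx0 map_mx0.
Qed.

Lemma mxtrace_sum n I (s : seq I) (F : I -> 'M[C]_n) :
  \tr (\sum_(i <- s) F i) = \sum_(i <- s) \tr (F i).
Proof. exact: raddf_sum. Qed.

Lemma mxtrace_adj n (A : 'M[C]_n) : \tr (A^t*) = (\tr A)^*.
Proof. by rewrite trace_map_mx mxtrace_tr. Qed.

(** Since [0 <=] in [C] includes being real, this condition forces [M] to be Hermitian. *)
Definition psdmx n (M : 'M[C]_n) := forall u : 'rV[C]_n, 0 <= (u *m M *m u^t*) 0 0.

Lemma psdmx_gram m n (G : 'M[C]_(m, n)) : psdmx (G *m G^t*).
Proof.
move=> u; rewrite mulmxA -mulmxA -adjmxM mxE.
by apply: sumr_ge0 => i _; rewrite !mxE mul_conjC_ge0.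
Qed.

Lemma psdmxD n (M N : 'M[C]_n) : psdmx M -> psdmx N -> psdmx (M + N).
Proof. by move=> hM hN u; rewrite mulmxDr mulmxDl mxE addr_ge0. Qed.

Lemma psdmxZ n (a : C) (M : 'M[C]_n) : 0 <= a -> psdmx M -> psdmx (a *: M).
Proof. by move=> a0 hM u; rewrite -scalemxAr -scalemxAl mxE mulr_ge0. Qed.

Lemma psdmx_congr m n (M : 'M[C]_n) (G : 'M[C]_(m, n)) :
  psdmx M -> psdmx (G *m M *m G^t*).
Proof. by move=> hM u; have := hM (u *m G); rewrite adjmxM !mulmxA. Qed.

Lemma psdmx_diag n (M : 'M[C]_n) i : psdmx M -> 0 <= M i i.
Proof.
move=> /(_ (delta_mx 0 i)); rewrite -rowE mxE (bigD1 i) //=.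
rewrite big1 ?addr0; first by rewrite !mxE !eqxx /= conjC1 mulr1.
by move=> j /negPf ji; rewrite !mxE ji andbF conjC0 mulr0.
Qed.

Lemma psdmx_trace n (M : 'M[C]_n) : psdmx M -> 0 <= \tr M.
Proof. by move=> hM; apply: sumr_ge0 => i _; apply: psdmx_diag. Qed.

Definition contraction m n (S : 'M[C]_(m, n)) := psdmx (1%:M - S *m S^t*).

Lemma contraction_mul m n p (S : 'M[C]_(m, n)) (T : 'M[C]_(n, p)) :
  contraction S -> contraction T -> contraction (S *m T).
Proof.
move=> hS hT; rewrite /contraction.
have -> : 1%:M - S *m T *m (S *m T)^t* =
    (1%:M - S *m S^t*) + S *m (1%:M - T *m T^t*) *m S^t*.
  by rewrite adjmxM mulmxBr mulmx1 mulmxBl !mulmxA addrA subrK.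
exact/psdmxD/psdmx_congr.
Qed.

(** With [H = S^t* *m S], the matrix [1 - H] is the sum of its own square, a Gram matrix, and of
    [H - H *m H], a congruence of [1 - S *m S^t*]. *)
Lemma contraction_adj m n (S : 'M[C]_(m, n)) : contraction S -> contraction (S^t*).
Proof.
move=> hS; rewrite /contraction trmxCK; set H := S^t* *m S.
have Hh : H^t* = H by rewrite adjmxM trmxCK.
have -> : 1%:M - H = (1%:M - H) *m (1%:M - H)^t* + S^t* *m (1%:M - S *m S^t*) *m (S^t*)^t*.
  rewrite trmxCK adjmxB adjmx1 Hh !mulmxBl !mulmxBr !mul1mx !mulmx1 mulmxBl.
  have -> : S^t* *m (S *m S^t*) *m S = H *m H by rewrite /H !mulmxA.
  by rewrite -/H subrK.
exact: psdmxD (psdmx_gram _) (psdmx_congr _ hS).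
Qed.

Lemma contraction1 n : contraction (1%:M : 'M[C]_n).
Proof. by move=> u; rewrite adjmx1 mulmx1 subrr mulmx0 mul0mx mxE. Qed.

(** Equivalently, every singular value of [J] is 0 or 1. *)
Definition pisometry m n (J : 'M[C]_(m, n)) := J *m J^t* *m J = J.

Lemma pisometry_adj m n (J : 'M[C]_(m, n)) : pisometry J -> pisometry (J^t*).
Proof. by rewrite /pisometry => hJ; rewrite -[in RHS]hJ !adjmxM trmxCK !mulmxA. Qed.

Lemma pisometry_contraction m n (J : 'M[C]_(m, n)) : pisometry J -> contraction J.
Proof.
move=> hJ; rewrite /contraction; set H := J *m J^t*.
have HH : H *m H = H by rewrite /H !mulmxA hJ.
have -> : 1%:M - H = (1%:M - H) *m (1%:M - H)^t*.
  rewrite adjmxB adjmx1 /H adjmxM trmxCK -/H mulmxBl !mulmxBr HH !mul1mx !mulmx1.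
  by rewrite subrr subr0.
exact: psdmx_gram.
Qed.

Definition orthoproj n (Q : 'M[C]_n) := Q^t* = Q /\ Q *m Q = Q.

Lemma orthoproj_compl n (Q : 'M[C]_n) : orthoproj Q -> orthoproj (1%:M - Q).
Proof.
move=> [Qh QQ]; split; first by rewrite adjmxB adjmx1 Qh.
by rewrite mulmxBl !mulmxBr QQ !mul1mx !mulmx1 subrr subr0.
Qed.

(* The trace of [J *m J^t*] is the rank of the partial isometry [J]. *)
Definition lowrank n (q : nat) (M : 'M[C]_n) := exists J S1 S2 : 'M[C]_n,
  [/\ M = S1 *m J *m S2, contraction S1, contraction S2, pisometry J &
      \tr (J *m J^t*) <= q%:R].

Lemma psdmx_compress n (Q S : 'M[C]_n) : orthoproj Q -> contraction S ->
  psdmx (Q - (Q *m S) *m (Q *m S)^t*).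
Proof.
move=> [Qh QQ] hS; have := psdmx_congr Q hS.
by rewrite mulmxBr mulmxBl mulmx1 Qh QQ adjmxM Qh !mulmxA.
Qed.

(** After cycling both traces, the difference is the trace of a congruence of [1 - S^t* *m S], which
    is positive because the adjoint of a contraction is a contraction. *)
Lemma trace_contraction_le n (S J : 'M[C]_n) : contraction S ->
  \tr ((S *m J) *m (S *m J)^t*) <= \tr (J *m J^t*).
Proof.
move=> hS; rewrite -subr_ge0 [X in X - _]mxtrace_mulC [X in _ - X]mxtrace_mulC.
rewrite -raddfB /=; apply: psdmx_trace.
have -> : J^t* *m J - (S *m J)^t* *m (S *m J) =
    J^t* *m (1%:M - S^t* *m (S^t*)^t*) *m (J^t*)^t*.
  by rewrite !trmxCK adjmxM mulmxBr mulmx1 mulmxBl !mulmxA.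
exact/psdmx_congr/contraction_adj.
Qed.

(** Inserting [J = J *m J^t* *m J] lets both factors of [S1 *m J *m S2] carry a copy of the low-rank
    core, hence the trace bounds; compressing each by [Q] gives the bounds by [Q]. The later
    polarization works with these two factors. *)
Lemma lowrank_factor n (Q M : 'M[C]_n) q : orthoproj Q -> lowrank q M ->
  Q *m M *m Q = M ->
  exists S T : 'M[C]_n, [/\ M = S *m T^t*, psdmx (Q - S *m S^t*),
    psdmx (Q - T *m T^t*), \tr (S *m S^t*) <= q%:R & \tr (T *m T^t*) <= q%:R].
Proof.
move=> hQ [J [S1 [S2 [MJ cS1 cS2 hJ Jq]]]] QMQ.
have [Qh QQ] := hQ.
have cQ : contraction Q by apply: pisometry_contraction; rewrite /pisometry Qh !QQ.
have cJ := pisometry_contraction hJ.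
have hJ' := pisometry_adj hJ.
exists (Q *m S1 *m J), (Q *m S2^t* *m J^t* *m J).
have cS2' := contraction_adj cS2; have cJ' := contraction_adj cJ.
split.
- have E : Q *m S1 *m J *m J^t* *m J = Q *m S1 *m J.
    by rewrite -[RHS]mulmxA -[in RHS]hJ !mulmxA.
  by rewrite !adjmxM !trmxCK Qh !mulmxA E -[in LHS]QMQ MJ !mulmxA.
- rewrite -[Q *m S1 *m J]mulmxA.
  exact: psdmx_compress hQ (contraction_mul cS1 cJ).
- have -> : Q *m S2^t* *m J^t* *m J = Q *m (S2^t* *m J^t* *m J) by rewrite !mulmxA.
  exact: psdmx_compress hQ (contraction_mul (contraction_mul cS2' cJ') cJ).
- exact: le_trans (trace_contraction_le _ (contraction_mul cQ cS1)) Jq.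
- apply: le_trans Jq; apply: trace_contraction_le.
  exact: contraction_mul (contraction_mul cQ cS2') cJ'.
Qed.

End PositiveSemidefinite.

Lemma sum_ltn_le n r : (\sum_(i < n) (i < r)%N <= r)%N.
Proof.
rewrite -big_mkcond /=; have [rn|nr] := leqP r n.
  by rewrite -(big_ord_widen _ (fun=> 1%N) rn) sum1_card card_ord.
by rewrite sum1_card (leq_trans (max_card _)) // card_ord ltnW.
Qed.

(** * Unitary diagonalization and attainment of the Ky Fan sum *)

Section UnitaryDiagonalization.
Variable C : numClosedFieldType.

Definition udiag n (W : 'M[C]_n) (a : 'I_n -> C) : 'M[C]_n :=
  W^t* *m diag_mx (\row_i a i) *m W.

Lemma unitarymxK n (W : 'M[C]_n) : W \is unitarymx -> W^t* *m W = 1%:M.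
Proof. by move=> hW; rewrite -(invmx_unitary hW) (mulVmx (unitarymx_unit hW)). Qed.

Lemma udiagM n (W : 'M[C]_n) a b : W \is unitarymx ->
  udiag W a *m udiag W b = udiag W (fun i => a i * b i).
Proof.
move=> hW; rewrite /udiag !mulmxA (mulmxtVK _ hW) -[_ *m diag_mx _ *m diag_mx _]mulmxA.
rewrite mulmx_diag; congr (_ *m diag_mx _ *m _).
by apply/rowP => i; rewrite !mxE.
Qed.

Lemma udiag_adj n (W : 'M[C]_n) a : (forall i, a i \is Num.real) ->
  (udiag W a)^t* = udiag W a.
Proof.
move=> ra; rewrite /udiag !adjmxM trmxCK mulmxA tr_diag_mx map_diag_mx.
congr (_ *m diag_mx _ *m _); apply/rowP => i; rewrite !mxE.
exact/CrealP.
Qed.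

Lemma udiag_trace n (W : 'M[C]_n) a : W \is unitarymx -> \tr (udiag W a) = \sum_i a i.
Proof.
move=> hW; rewrite /udiag mxtrace_mulC mulmxA (unitarymxP hW) mul1mx mxtrace_diag.
by apply: eq_bigr => i _; rewrite mxE.
Qed.

Lemma eq_udiag n (W : 'M[C]_n) a b : a =1 b -> udiag W a = udiag W b.
Proof. by move=> ab; congr (_ *m diag_mx _ *m _); apply/rowP => i; rewrite !mxE ab. Qed.

Lemma char_poly_similar n (U D V : 'M[C]_n) : U *m V = 1%:M ->
  char_poly (U *m D *m V) = char_poly D.
Proof.
move=> UV; rewrite /char_poly.
have UV' : map_mx polyC U *m map_mx polyC V = 1%:M.
  by rewrite -map_mxM UV map_mx1.
have -> : char_poly_mx (U *m D *m V) =
    map_mx polyC U *m char_poly_mx D *m map_mx polyC V.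
  rewrite /char_poly_mx mulmxBr mulmxBl !map_mxM /=.
  by rewrite scalar_mxC -[_%:M *m _ *m _]mulmxA UV' mulmx1.
by rewrite !det_mulmx mulrAC -det_mulmx UV' det1 mul1r.
Qed.

Lemma char_poly_udiag n (W : 'M[C]_n) a : W \is unitarymx ->
  char_poly (udiag W a) = \prod_(x <- codom a) ('X - x%:P).
Proof.
move=> hW; rewrite char_poly_similar; last exact: unitarymxK.
rewrite char_poly_trig ?diag_mx_is_trig // big_map big_enum /=.
by apply: eq_bigr => i _; rewrite !mxE eqxx.
Qed.

Lemma udiag_unitary_mul n (W U : 'M[C]_n) a :
  U^t* *m udiag W a *m U = udiag (W *m U) a.
Proof. by rewrite /udiag adjmxM !mulmxA. Qed.

Lemma hermitian_udiag n (A : 'M[C]_n) : A \is hermsymmx ->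
  exists (W : 'M[C]_n) (a : 'I_n -> C),
    [/\ W \is unitarymx, (forall i, a i \is Num.real) & A = udiag W a].
Proof.
move=> hA; exists (spectralmx A), (fun i => spectral_diag A ord0 i).
have hW := spectral_unitarymx A; split=> //.
  by move=> i; have /mxOverP := hermitian_spectral_diag_real hA; apply.
have /orthomx_spectralP {1}-> := hermitian_normalmx hA.
rewrite /udiag invmx_unitary //; congr (_ *m diag_mx _ *m _).
by apply/rowP => i; rewrite mxE.
Qed.

Lemma udiag_row_perm n (W : 'M[C]_n) a (s : 'S_n) :
  udiag (row_perm s W) (a \o s) = udiag W a.
Proof.
apply/matrixP => i j; rewrite /udiag !mxE [RHS](reindex_inj (@perm_inj _ s)) /=.
apply: eq_bigr => k _; rewrite !mul_mx_diag !mxE /=.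
by congr (_ * _ * _); rewrite !mxE.
Qed.

Lemma row_perm_unitary n (W : 'M[C]_n) (s : 'S_n) : W \is unitarymx ->
  row_perm s W \is unitarymx.
Proof.
move=> hW; apply/unitarymxP/matrixP => i j.
have /matrixP/(_ (s i) (s j)) := unitarymxP hW.
rewrite !mxE (inj_eq perm_inj) => <-; apply: eq_bigr => k _.
by rewrite !mxE.
Qed.

(* The partial isometry is the sign of [D] cut down to its [r] largest
   eigenvalues in absolute value. *)
Lemma kyfan_attained n (W : 'M[C]_n) a (s : 'S_n) r : W \is unitarymx ->
  (forall i, a i \is Num.real) ->
  exists Z : 'M[C]_n, [/\ Z^t* = Z, pisometry Z, \tr (Z *m Z^t*) <= r%:R &
    \tr (Z *m udiag W a) = \sum_(i < n | (i < r)%N) `|a (s i)|].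
Proof.
move=> hW ra; pose t i := ((s^-1)%g : {perm _}) i; pose e i := (t i < r)%N%:R * Num.sg (a i).
have re i : e i \is Num.real.
  by rewrite rpredM ?realn // sgr_def rpredMn // rpredX // rpredN1.
have ee i : e i * e i = ((t i < r)%N && (a i != 0))%:R.
  by rewrite mulrACA -expr2 -expr2 sqr_sg -natrX -natrM; case: (_ < _)%N; case: eqP.
have Zh := udiag_adj W re.
exists (udiag W e); split=> //.
- rewrite /pisometry Zh !udiagM //; apply: eq_udiag => i; rewrite ee /e.
  have [->|ai] := eqVneq (a i) 0; first by rewrite sgr0 !mulr0.
  by case: (_ < _)%N; rewrite ?mul0r ?mul1r.
- rewrite Zh udiagM // udiag_trace // (eq_bigr _ (fun i _ => ee i)).
  apply: (@le_trans _ _ (\sum_i (t i < r)%N%:R)).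
    by apply: ler_sum => i _; rewrite ler_nat; case: (_ < _)%N; case: (_ == _).
  rewrite (reindex_inj (@perm_inj _ s)) /=.
  under eq_bigr do rewrite /t permK.
  by rewrite -natr_sum ler_nat sum_ltn_le.
- rewrite udiagM // udiag_trace // (reindex_inj (@perm_inj _ s)) /=.
  rewrite [RHS]big_mkcond /=; apply: eq_bigr => i _.
  rewrite /e /t permK; case: (_ < _)%N; rewrite ?mul0r // mul1r.
  rewrite {2}(realEsg (ra (s i))) mulrA -expr2 sqr_sg.
  by have [->|] := eqVneq (a (s i)) 0; rewrite ?normr0 ?mulr0 ?mul1r.
Qed.

End UnitaryDiagonalization.

(** * Spectral spread of commutators *)

Section SpectralSpread.
Variable C : numClosedFieldType.

(* [(l_i - c)(p_i - [i < q]) <= 0] for every [i]. *)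
Lemma weighted_sum_le d q (l p : 'I_d -> C) (c : C) : (q <= d)%N ->
  (forall i : 'I_d, (i < q)%N -> c <= l i) ->
  (forall i : 'I_d, (q <= i)%N -> l i <= c) ->
  (forall i, 0 <= p i <= 1) ->
  \sum_i l i * p i <= \sum_(i < d | (i < q)%N) l i + c * (\sum_i p i - q%:R).
Proof.
move=> qd hlo hhi hp.
have -> : q%:R = \sum_(i < d) (i < q)%N%:R :> C.
  rewrite -natr_sum -big_mkcond /= -(big_ord_widen _ (fun=> 1%N) qd).
  by rewrite sum1_card card_ord.
rewrite -sumrB mulr_sumr [X in _ <= X + _]big_mkcond /= -big_split /=.
apply: ler_sum => i _; rewrite -subr_le0.
have /andP[p0 p1] := hp i.
case: ltnP => qi.
  have -> : l i * p i - (l i + c * (p i - true%:R)) = (l i - c) * (p i - 1).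
    by rewrite /=; ring.
  by rewrite mulr_ge0_le0 // ?subr_ge0 ?subr_le0 ?hlo.
rewrite add0r subr0 -mulrBl mulr_le0_ge0 // subr_le0.
exact: hhi.
Qed.

Lemma psd_unitary_diag n (W P : 'M[C]_n) i : W \is unitarymx -> psdmx P ->
  psdmx (1%:M - P) -> 0 <= (W *m P *m W^t*) i i <= 1.
Proof.
move=> hW P0 P1; apply/andP; split; first exact/psdmx_diag/psdmx_congr.
have := psdmx_diag i (psdmx_congr W P1).
by rewrite mulmxBr mulmx1 mulmxBl (unitarymxP hW) !mxE eqxx subr_ge0.
Qed.

Lemma udiag_mul_trace n (W P : 'M[C]_n) a :
  \tr (udiag W a *m P) = \sum_i a i * (W *m P *m W^t*) i i.
Proof.
rewrite /udiag -!mulmxA mxtrace_mulC -!mulmxA /mxtrace.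
by apply: eq_bigr => i _; rewrite mul_diag_mx mxE [in LHS]mxE !mulmxA.
Qed.

Lemma unitary_conj_trace n (W P : 'M[C]_n) : W \is unitarymx ->
  \sum_i (W *m P *m W^t*) i i = \tr P.
Proof. by move=> hW; rewrite -/(mxtrace _) mxtrace_mulC mulmxA unitarymxK ?mul1mx. Qed.

Variables (d : nat) (l : nat -> C).
Hypothesis l_anti : forall i j, (i <= j < d)%N -> l j <= l i.

(** In the eigenbasis both traces become sums of eigenvalues with weights in [[0, 1]] of equal total
    at most [q]. The first is compared with full weight on the [q] largest eigenvalues, the second
    with full weight on the [q] smallest. *)
Lemma spread_trace_le (W P N : 'M[C]_d) q : W \is unitarymx -> (q.*2 <= d)%N ->
  psdmx P -> psdmx (1%:M - P) -> psdmx N -> psdmx (1%:M - N) ->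
  \tr P = \tr N -> \tr P <= q%:R ->
  \tr (udiag W (fun i => l i) *m (P - N)) <= \sum_(i < q) (l i - l (d.-1 - i)%N).
Proof.
move=> hW qd P0 P1 N0 N1 trPN trP.
case: d W P N l_anti qd hW P0 P1 N0 N1 trPN trP => [|d'] W P N lA qd hW P0 P1 N0 N1 trPN trP.
  have -> : q = 0%N by lia.
  by rewrite big_ord0 /mxtrace big_ord0.
have qd1 : (q <= d'.+1)%N by rewrite (leq_trans _ qd) // -addnn leq_addr.
have qp : (q.-1 <= d')%N by lia.
rewrite mulmxBr raddfB /= !udiag_mul_trace.
set p := fun i => (W *m P *m W^t*) i i.
set m := fun i => (W *m N *m W^t*) i i.
have hp i : 0 <= p i <= 1 by apply: psd_unitary_diag.
have hm i : 0 <= m i <= 1 by apply: psd_unitary_diag.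
have sp : \sum_i p i = \tr P by apply: unitary_conj_trace.
have sm : \sum_i m i = \tr P by rewrite trPN; apply: unitary_conj_trace.
(* The threshold is the [q]-th largest eigenvalue here and the [q]-th smallest in [H2], which runs
   through the reversed and negated list (for [q = 0], truncation gives the two extreme
   eigenvalues). The corrections add up to the gap between the thresholds times [\tr P - q], which
   is nonpositive. *)
have H1 := @weighted_sum_le _ q (fun i => l i) p (l q.-1) qd1.
have H2 := @weighted_sum_le _ q (fun i => - l (d' - i)%N) (fun i => m (rev_ord i))
  (- l (d' - q.-1)%N) qd1.
rewrite sp in H1.
have sm' : \sum_i m (rev_ord i) = \tr P by rewrite -sm [RHS](reindex_inj rev_ord_inj).
rewrite sm' in H2.
have {}H1 := H1 _ _ hp.
have {}H2 := H2 _ _ (fun i => hm (rev_ord i)).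
have E2 : \sum_(i < d'.+1) l i * m i = - \sum_(i < d'.+1) - l (d' - i)%N * m (rev_ord i).
  rewrite [LHS](reindex_inj rev_ord_inj) -sumrN; apply: eq_bigr => i _.
  by rewrite /= subSS mulNr opprK.
have W1 (F : nat -> C) : \sum_(i < d'.+1 | (i < q)%N) F i = \sum_(i < q) F i.
  by rewrite (big_ord_widen _ F qd1).
rewrite E2 opprK.
apply: le_trans (lerD (H1 _ _) (H2 _ _)) _.
- by move=> i iq; apply: lA; lia.
- by move=> i qi; apply: lA; have := ltn_ord i; lia.
- by move=> i iq; rewrite lerN2; apply: lA; lia.
- by move=> i qi; rewrite lerN2; apply: lA; lia.
rewrite W1 (W1 (fun i => - l (d' - i)%N)) sumrN sumrB.
rewrite addrACA gerDl mulNr -mulrBl mulr_ge0_le0 ?subr_le0 // subr_ge0.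
by apply: lA; lia.
Qed.

End SpectralSpread.

Section CommutatorSpread.
Variables (C : numClosedFieldType) (d : nat) (l : nat -> C).
Hypothesis l_anti : forall i j, (i <= j < d)%N -> l j <= l i.
Hypothesis l_real : forall i, l i \is Num.real.
Variables (P Q : 'M[C]_d).
Hypothesis PQ : P + Q = 1%:M.

(* Polarization writes the Hermitian part of [S T^* - S' T'^*] as a difference
   of two positive contractions of trace at most [q]. *)
Lemma factored_trace_le (W S T S' T' : 'M[C]_d) q : W \is unitarymx -> (q.*2 <= d)%N ->
  psdmx (Q - S *m S^t*) -> psdmx (Q - T *m T^t*) ->
  psdmx (P - S' *m S'^t*) -> psdmx (P - T' *m T'^t*) ->
  \tr (S *m S^t*) <= q%:R -> \tr (T *m T^t*) <= q%:R ->
  \tr (S' *m S'^t*) <= q%:R -> \tr (T' *m T'^t*) <= q%:R ->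
  \tr (S *m T^t*) = \tr (S' *m T'^t*) ->
  let z := \tr (udiag W (fun i => l i) *m (S *m T^t* - S' *m T'^t*)) in
  z + z^* <= (\sum_(i < q) (l i - l (d.-1 - i)%N)) *+ 2.
Proof.
move=> hW qd hS hT hS' hT' tS tT tS' tT' tST /=.
set A := udiag _ _.
have Ah : A^t* = A by apply: udiag_adj => i; apply: l_real.
pose gp (X Y : 'M[C]_d) := (X + Y) *m (X + Y)^t*.
pose gm (X Y : 'M[C]_d) := (X - Y) *m (X - Y)^t*.
have gpE X Y : gp X Y = X *m X^t* + X *m Y^t* + (Y *m X^t* + Y *m Y^t*).
  by rewrite /gp adjmxD mulmxDl !mulmxDr.
have gmE X Y : gm X Y = X *m X^t* - X *m Y^t* - (Y *m X^t* - Y *m Y^t*).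
  by rewrite /gm adjmxB mulmxBl !mulmxBr.
have p4 : 0 <= (4^-1 : C) by rewrite invr_ge0 ler0n.
have p2 : 0 <= (2^-1 : C) by rewrite invr_ge0 ler0n.
(* Exchanging [gp] and [gm] on the primed pair produces the minus sign: [P1 - P2] is half the sum of
   [S *m T^t* - S' *m T'^t*] and its adjoint. *)
pose P1 := 4^-1 *: (gp S T + gm S' T').
pose P2 := 4^-1 *: (gm S T + gp S' T').
have P10 : psdmx P1 by apply: psdmxZ => //; apply: psdmxD; apply: psdmx_gram.
have P20 : psdmx P2 by apply: psdmxZ => //; apply: psdmxD; apply: psdmx_gram.
(* [D] collects the slack in the four bounds by [Q] and [P]. It is exactly what [P1 + P2] lacks to
   be the identity, so neither [P1] nor [P2] exceeds the identity. *)
pose D := 2^-1 *: ((Q - S *m S^t*) + (Q - T *m T^t*) +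
                   ((P - S' *m S'^t*) + (P - T' *m T'^t*))).
have D0 : psdmx D by apply: psdmxZ => //; do 2?apply: psdmxD => //; apply: psdmxD.
have Psum : 1%:M = D + P1 + P2.
  rewrite -PQ /D /P1 /P2 !gpE !gmE; apply/matrixP => i j.
  do ![rewrite [in RHS]mxE | rewrite [in LHS]mxE].
  by field.
have P11 : psdmx (1%:M - P1).
  by rewrite Psum [D + P1 + P2]addrAC addrK; apply: psdmxD.
have P21 : psdmx (1%:M - P2) by rewrite Psum addrK; apply: psdmxD.
have tr_adj (X Y : 'M[C]_d) : \tr (Y *m X^t*) = (\tr (X *m Y^t*))^*.
  by rewrite -mxtrace_adj adjmxM trmxCK.
have tgp X Y : \tr (gp X Y) = \tr (X *m X^t*) + \tr (X *m Y^t*) +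
    ((\tr (X *m Y^t*))^* + \tr (Y *m Y^t*)).
  by rewrite gpE !raddfD /= (tr_adj X Y).
have tgm X Y : \tr (gm X Y) = \tr (X *m X^t*) - \tr (X *m Y^t*) -
    ((\tr (X *m Y^t*))^* - \tr (Y *m Y^t*)).
  by rewrite gmE !raddfB /= (tr_adj X Y).
(* The cross terms cancel because [S *m T^t*] and [S' *m T'^t*] have equal traces; the same
   cancellation gives [P2] the same trace. *)
have tP1 : \tr P1 = 4^-1 * (\tr (S *m S^t*) + \tr (T *m T^t*) +
    (\tr (S' *m S'^t*) + \tr (T' *m T'^t*))).
  by rewrite linearZ /= linearD /= tgp tgm tST; ring.
have tP2 : \tr P2 = \tr P1.
  by rewrite tP1 linearZ /= linearD /= tgm tgp tST; ring.
have tP : \tr P1 <= q%:R.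
  rewrite tP1 mulrC ler_pdivrMr ?ltr0n //.
  have -> : q%:R * 4 = q%:R + q%:R + (q%:R + q%:R) :> C by ring.
  by do ?apply: lerD.
have := spread_trace_le l_anti hW qd P10 P11 P20 P21 (esym tP2) tP.
rewrite -/A; set z := \tr (A *m (S *m T^t* - S' *m T'^t*)); set b := \sum_(i < q) _ => zb.
rewrite (_ : z + _ = \tr (A *m (P1 - P2)) *+ 2) ?lerMn2r ?zb ?orbT //.
rewrite /z.
have -> : P1 - P2 = 2^-1 *: (S *m T^t* - S' *m T'^t* + (T *m S^t* - T' *m S'^t*)).
  rewrite /P1 /P2 !gpE !gmE; apply/matrixP => i j.
  do ![rewrite [in RHS]mxE | rewrite [in LHS]mxE].
  by field.
have trA : \tr (A *m (T *m S^t* - T' *m S'^t*)) =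
    (\tr (A *m (S *m T^t* - S' *m T'^t*)))^*.
  by rewrite -mxtrace_adj adjmxM Ah adjmxB !adjmxM !trmxCK [RHS]mxtrace_mulC.
move: trA; set M := _ - _; set N := _ - _ => trA; clearbody M N.
by rewrite -scalemxAr linearZ /= mulmxDr linearD /= trA; field.
Qed.

Hypotheses (hP : orthoproj P) (hQ : orthoproj Q).

(** [V *m E^t*] lives on the range of [Q] and [E^t* *m V] on that of [P], so the two products are
    factored separately under complementary projections. Cyclicity of the trace supplies the
    equality of traces that the polarization requires. *)
Lemma commutator_trace_le (W V E : 'M[C]_d) q : W \is unitarymx -> (q.*2 <= d)%N ->
  Q *m V = V -> V *m P = V -> Q *m E = E -> E *m P = E ->
  lowrank q (V *m E^t*) -> lowrank q (E^t* *m V) ->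
  let z := \tr (udiag W (fun i => l i) *m (V *m E^t* - E^t* *m V)) in
  z + z^* <= (\sum_(i < q) (l i - l (d.-1 - i)%N)) *+ 2.
Proof.
move=> hW qd QV VP QE EP hM hN.
have [[Ph _] [Qh _]] := (hP, hQ).
have EQ : E^t* *m Q = E^t* by rewrite -[in RHS]QE adjmxM Qh.
have PE : P *m E^t* = E^t* by rewrite -[in RHS]EP adjmxM Ph.
have [|S [T [eM s1 s2 s3 s4]]] := lowrank_factor hQ hM.
  by rewrite !mulmxA QV -mulmxA EQ.
have [|S' [T' [eN s1' s2' s3' s4']]] := lowrank_factor hP hN.
  by rewrite !mulmxA PE -mulmxA VP.
rewrite eM eN; apply: factored_trace_le => //.
by rewrite -eM -eN mxtrace_mulC.
Qed.

(** Any of the three factors can serve as the core, the others being contractions; the one with the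
    least bound is chosen. *)
Lemma lowrank_mul3 (J1 J2 J3 : 'M[C]_d) q1 q2 q3 :
  pisometry J1 -> pisometry J2 -> pisometry J3 ->
  \tr (J1 *m J1^t*) <= q1%:R -> \tr (J2 *m J2^t*) <= q2%:R ->
  \tr (J3 *m J3^t*) <= q3%:R ->
  lowrank (minn q1 (minn q2 q3)) (J1 *m J2 *m J3).
Proof.
move=> h1 h2 h3 t1 t2 t3.
have c1 := pisometry_contraction h1.
have c2 := pisometry_contraction h2.
have c3 := pisometry_contraction h3.
have c0 : contraction (1%:M : 'M[C]_d) by exact: contraction1.
rewrite /minn; case: ifP => _; last case: ifP => _.
- exists J1, 1%:M, (J2 *m J3); split=> //; first by rewrite mul1mx mulmxA.
  exact: contraction_mul.
- by exists J2, J1, J3.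
- exists J3, (J1 *m J2), 1%:M; split=> //; first by rewrite mulmx1.
  exact: contraction_mul.
Qed.

End CommutatorSpread.

(** * Matrix-valued functions of a real variable *)

Section MatrixDerivatives.
Variable R : realType.
Local Notation C := (R[i]).
Local Notation Re := (@complex.Re R).
Local Notation Im := (@complex.Im R).

Lemma is_derive_le (f g df dg : R -> R) (a b : R) : a <= b ->
  (forall t : R, is_derive t 1 f (df t)) -> (forall t : R, is_derive t 1 g (dg t)) ->
  (forall t, a <= t <= b -> df t <= dg t) -> f b - f a <= g b - g a.
Proof.
move=> ab hf hg hle.
have hgf (t : R) : is_derive t 1 (g - f) (dg t - df t) by exact: is_deriveB.
have [|c cab] := @MVT_segment R (g - f) (fun t => dg t - df t) a b ab.
- apply: continuous_subspaceT => x; apply: differentiable_continuous.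
  by apply/derivable1_diffP; case: (hgf x).
rewrite in_itv /= in cab => /= e.
have : 0 <= (g - f) b - (g - f) a.
  by rewrite e mulr_ge0 ?subr_ge0 // hle.
have -> : (g - f) b - (g - f) a = g b - g a - (f b - f a).
  by rewrite !fctE; ring.
by rewrite subr_ge0.
Qed.

Lemma ReD (x y : C) : Re (x + y) = Re x + Re y. Proof. by case: x; case: y. Qed.
Lemma ImD (x y : C) : Im (x + y) = Im x + Im y. Proof. by case: x; case: y. Qed.
Lemma ReN (x : C) : Re (- x) = - Re x. Proof. by case: x. Qed.
Lemma ReM (x y : C) : Re (x * y) = Re x * Re y - Im x * Im y.
Proof. by case: x; case: y. Qed.
Lemma ImM (x y : C) : Im (x * y) = Re x * Im y + Im x * Re y.
Proof. by case: x; case: y. Qed.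
Lemma Re_conj (x : C) : Re (Num.conj x) = Re x. Proof. by case: x. Qed.
Lemma Im_conj (x : C) : Im (Num.conj x) = - Im x. Proof. by case: x. Qed.
Lemma Re_sum I (s : seq I) (F : I -> C) :
  Re (\sum_(i <- s) F i) = \sum_(i <- s) Re (F i).
Proof. exact: (big_morph Re ReD). Qed.
Lemma Im_sum I (s : seq I) (F : I -> C) :
  Im (\sum_(i <- s) F i) = \sum_(i <- s) Im (F i).
Proof. exact: (big_morph Im ImD). Qed.

(** Real and imaginary parts of each entry are differentiated separately, so that only calculus of
    real functions of one variable is involved. *)
Definition mxderive m n (F : R -> 'M[C]_(m, n)) (t : R) (L : 'M[C]_(m, n)) :=
  forall i j, is_derive t 1 (fun x => Re (F x i j)) (Re (L i j)) /\
              is_derive t 1 (fun x => Im (F x i j)) (Im (L i j)).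

Lemma mxderive_cst m n (A : 'M[C]_(m, n)) t : mxderive (fun=> A) t 0.
Proof. by move=> i j; rewrite mxE; split; exact: is_derive_cst. Qed.

Lemma mxderiveD m n (F G : R -> 'M[C]_(m, n)) t L K :
  mxderive F t L -> mxderive G t K -> mxderive (fun x => F x + G x) t (L + K).
Proof.
move=> hF hG i j; have [[f1 f2] [g1 g2]] := (hF i j, hG i j).
rewrite mxE ReD ImD; split.
  under eq_fun do rewrite mxE ReD.
  exact: is_deriveD.
under eq_fun do rewrite mxE ImD.
exact: is_deriveD.
Qed.

Lemma is_derive_bigsum n (f : 'I_n -> R -> R) (df : 'I_n -> R) (t : R) :
  (forall i, is_derive t 1 (f i) (df i)) ->
  is_derive t 1 (fun x => \sum_i f i x) (\sum_i df i).
Proof.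
move=> hf; have -> : (fun x => \sum_i f i x) = \sum_i f i.
  by apply/funext => x; rewrite fct_sumE.
exact: is_derive_sum.
Qed.

Lemma is_derive_mul (f g : R -> R) (df dg t : R) :
  is_derive t 1 f df -> is_derive t 1 g dg ->
  is_derive t 1 (fun x => f x * g x) (df * g t + f t * dg).
Proof.
move=> hf hg; apply: is_derive_eq (is_deriveM hf hg) _.
by rewrite addrC [g t *: _]mulrC.
Qed.

Lemma mxderiveM m n p (F : R -> 'M[C]_(m, n)) (G : R -> 'M[C]_(n, p)) t L K :
  mxderive F t L -> mxderive G t K ->
  mxderive (fun x => F x *m G x) t (L *m G t + F t *m K).
Proof.
move=> hF hG i j; rewrite mxE !mxE -big_split /= Re_sum Im_sum; split.
  under eq_fun do rewrite mxE Re_sum.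
  apply: is_derive_bigsum => k; under eq_fun do rewrite ReM.
  have [[f1 f2] [g1 g2]] := (hF i k, hG k j).
  apply: is_derive_eq (is_deriveB (is_derive_mul f1 g1) (is_derive_mul f2 g2)) _.
  by rewrite ReD !ReM; ring.
under eq_fun do rewrite mxE Im_sum.
apply: is_derive_bigsum => k; under eq_fun do rewrite ImM.
have [[f1 f2] [g1 g2]] := (hF i k, hG k j).
apply: is_derive_eq (is_deriveD (is_derive_mul f1 g2) (is_derive_mul f2 g1)) _.
by rewrite ImD !ImM; ring.
Qed.

Lemma mxderive_adj m n (F : R -> 'M[C]_(m, n)) t L :
  mxderive F t L -> mxderive (fun x => (F x)^t*) t (L^t*).
Proof.
move=> hF i j; have [f1 f2] := hF j i; rewrite 2!mxE Re_conj Im_conj; split.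
  by under eq_fun do rewrite 2!mxE Re_conj.
under eq_fun do rewrite 2!mxE Im_conj.
exact: is_deriveN.
Qed.

Lemma mxderive_trace n (F : R -> 'M[C]_n) t L : mxderive F t L ->
  is_derive t 1 (fun x => Re (\tr (F x))) (Re (\tr L)).
Proof.
move=> hF; rewrite Re_sum; under eq_fun do rewrite Re_sum.
by apply: is_derive_bigsum => i; case: (hF i i).
Qed.

End MatrixDerivatives.

(** * Traces against the commutator with the generator [E - E^t*] *)

Section RotationGenerator.
Variables (C : numClosedFieldType) (d : nat) (P Q E : 'M[C]_d).
Hypotheses (hP : orthoproj P) (PQ : P + Q = 1%:M).
Hypotheses (QE : Q *m E = E) (EP : E *m P = E).

Lemma orthoproj_mul0 : P *m Q = 0.
Proof.
have [_ PP] := hP; have -> : Q = 1%:M - P by rewrite -PQ addrC addKr.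
by rewrite mulmxBr mulmx1 PP subrr.
Qed.

Lemma offdiag_mul0 (X Y : 'M[C]_d) : X *m P = X -> Q *m Y = Y -> X *m Y = 0.
Proof.
by move=> XP QY; rewrite -XP -QY mulmxA -[X *m P *m Q]mulmxA orthoproj_mul0 mulmx0 mul0mx.
Qed.

(** [Z] lives on the range of [P] while [E] takes values in that of [Q], so [Z *m E] and [E^t* *m Z]
    vanish. The two surviving terms are conjugate to each other. *)
Lemma trace_comm_corner (Z A : 'M[C]_d) : Z^t* = Z -> A^t* = A -> Z *m P = Z ->
  \tr (Z *m (A *m (E - E^t*) - (E - E^t*) *m A)) =
  \tr (E *m Z *m A) + (\tr (E *m Z *m A))^*.
Proof.
move=> Zh Ah ZP; have ZE := offdiag_mul0 ZP QE.
have EZ : E^t* *m Z = 0.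
  by rewrite -[E^t* *m Z]trmxCK adjmxM trmxCK Zh ZE linear0 map_mx0.
have e1 : \tr (Z *m (A *m (E - E^t*))) = \tr (E *m Z *m A).
  by rewrite mulmxA mxtrace_mulC mulmxA mulmxBl EZ subr0.
have e2 : \tr (Z *m ((E - E^t*) *m A)) = - \tr (Z *m E^t* *m A).
  by rewrite mulmxA mulmxBr ZE sub0r mulNmx raddfN.
rewrite mulmxBr raddfB /= e1 e2 opprK; congr (_ + _).
by rewrite -mxtrace_adj !adjmxM Zh Ah [RHS]mxtrace_mulC.
Qed.

(** Both [V *m E] and [E *m V] vanish because [P *m Q = 0], so only the [E^t*] half of the generator
    contributes. What remains has the form bounded by [commutator_trace_le]. *)
Lemma trace_comm_offdiag (V A : 'M[C]_d) : Q *m V = V -> V *m P = V ->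
  \tr (V *m (A *m (E - E^t*) - (E - E^t*) *m A)) =
  \tr (A *m (V *m E^t* - E^t* *m V)).
Proof.
move=> QV VP; have VE := offdiag_mul0 VP QE; have EV := offdiag_mul0 EP QV.
have e1 : \tr (V *m (A *m (E - E^t*))) = - \tr (A *m (E^t* *m V)).
  rewrite [V *m (A *m _)]mulmxA mxtrace_mulC [_ *m (V *m A)]mulmxA mulmxBl EV.
  by rewrite sub0r mulNmx raddfN /= [in RHS]mxtrace_mulC.
have e2 : \tr (V *m ((E - E^t*) *m A)) = - \tr (A *m (V *m E^t*)).
  rewrite [V *m (_ *m A)]mulmxA mulmxBr VE sub0r mulNmx raddfN /=.
  by rewrite [in RHS]mxtrace_mulC.
rewrite mulmxBr raddfB /= e1 e2 opprK [A *m (_ - _)]mulmxBr raddfB /=.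
by rewrite addrC.
Qed.

End RotationGenerator.

(** * Two mean value inequalities along the flow *)

Section FlowBound.
Variable R : realType.
Local Notation C := (R[i]).
Local Notation Re := (@complex.Re R).
Local Notation toC := (real_complex R).

Lemma Re_le_real (z : C) (b : R) : z + Num.conj z <= toC b *+ 2 -> Re z <= b.
Proof.
case: z => x y; rewrite -[_ *+ 2](rmorphMn toC) lecE /= => /andP[_].
by rewrite mulr2n; lra.
Qed.

Lemma Re_mulr (a : R) (z : C) : Re (toC a * z) = a * Re z.
Proof. by rewrite ReM /= mul0r subr0. Qed.

Variables (d m r : nat) (lam dl : nat -> R).
Hypothesis lam_anti : forall i j, (i <= j < d)%N -> lam j <= lam i.
Hypothesis dl_ge0 : forall j, 0 <= dl j.
Hypothesis md : (m.*2 <= d)%N.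
Variables (P Q Z : 'M[C]_d) (J : nat -> 'M[C]_d).
Hypotheses (hP : orthoproj P) (hQ : orthoproj Q) (PQ : P + Q = 1%:M).
Hypotheses (Zh : Z^t* = Z) (Zi : pisometry Z) (ZP : Z *m P = Z).
Hypothesis Zr : \tr (Z *m Z^t*) <= r%:R.
Hypothesis QJ : forall j, Q *m J j = J j.
Hypothesis JP : forall j, J j *m P = J j.
Hypothesis Ji : forall j, pisometry (J j).
Hypothesis Jr : forall j, \tr (J j *m (J j)^t*) <= j%:R.
Variables (W A : R -> 'M[C]_d).
Hypothesis hW : forall t, W t \is unitarymx.
Hypothesis AW : forall t, A t = udiag (W t) (fun i => toC (lam i)).
(** The pieces start at [J 1] because [J j] has rank at most [j]; the weight [dl j] will be the gap
    between two consecutive angles. *)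
Let E := \sum_(j < m) toC (dl j) *: J j.+1.
Hypothesis dA : forall t, mxderive A t (A t *m (E - E^t*) - (E - E^t*) *m A t).
Hypothesis A0 : Q *m A 0 *m P = 0.

Definition spread_sum q := \sum_(i < q) (lam i - lam (d.-1 - i)%N).

Let lamC i := toC (lam i).

Let lamC_anti i j : (i <= j < d)%N -> lamC j <= lamC i.
Proof. by move=> ij; rewrite lecR lam_anti. Qed.

Let lamC_real i : lamC i \is Num.real.
Proof. by apply/complex_realP; exists (lam i). Qed.

Let A_herm t : (A t)^t* = A t.
Proof. by rewrite AW; apply: udiag_adj => i; apply: lamC_real. Qed.

(** With [V = J a *m Z], both [V *m (J b)^t*] and [(J b)^t* *m V] are products of three partial
    isometries of ranks at most [a], [r] and [b], so [commutator_trace_le] applies with the minimum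
    of the three. *)
Lemma spread_piece_le t a b : (a.*2 <= d)%N ->
  Re (\tr (A t *m (J a *m Z *m (J b)^t* - (J b)^t* *m (J a *m Z)))) <=
  spread_sum (minn r (minn a b)).
Proof.
move=> ad; apply: Re_le_real.
have qd : ((minn r (minn a b)).*2 <= d)%N by lia.
have eS : toC (spread_sum (minn r (minn a b))) =
    \sum_(i < minn r (minn a b)) (lamC i - lamC (d.-1 - i)%N).
  by rewrite rmorph_sum; apply: eq_bigr => i _; rewrite rmorphB.
rewrite eS AW.
have JPa : J a *m Z *m P = J a *m Z by rewrite -mulmxA ZP.
have QJa : Q *m (J a *m Z) = J a *m Z by rewrite mulmxA QJ.
have Jadj : \tr ((J b)^t* *m (J b)^t*^t*) <= b%:R by rewrite trmxCK mxtrace_mulC Jr.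
have hb := pisometry_adj (Ji b).
have l1 : lowrank (minn r (minn a b)) (J a *m Z *m (J b)^t*).
  have := lowrank_mul3 (Ji a) Zi hb (Jr a) Zr Jadj.
  by congr lowrank; lia.
have l2 : lowrank (minn r (minn a b)) ((J b)^t* *m (J a *m Z)).
  have := lowrank_mul3 hb (Ji a) Zi Jadj (Jr a) Zr.
  by rewrite mulmxA; congr lowrank; lia.
exact: (commutator_trace_le lamC_anti lamC_real PQ hP hQ (hW t) qd QJa JPa (QJ b) (JP b) l1 l2).
Qed.

Let QE : Q *m E = E.
Proof.
by rewrite mulmx_sumr; apply: eq_bigr => j _; rewrite -scalemxAr QJ.
Qed.

Let EP : E *m P = E.
Proof.
by rewrite mulmx_suml; apply: eq_bigr => j _; rewrite -scalemxAl JP.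
Qed.

Let chi j t := Re (\tr (J j *m Z *m A t)).
Let chi' j t :=
  \sum_(l < m) dl l * Re (\tr (A t *m (J j *m Z *m (J l.+1)^t* - (J l.+1)^t* *m (J j *m Z)))).

Let dchi j (t : R) : is_derive t 1 (chi j) (chi' j t).
Proof.
have dF : mxderive (fun x => J j *m Z *m A x) t
    (0 *m A t + J j *m Z *m (A t *m (E - E^t*) - (E - E^t*) *m A t)).
  exact: mxderiveM (mxderive_cst _ _) (dA t).
apply: is_derive_eq (mxderive_trace dF) _.
have JPa : J j *m Z *m P = J j *m Z by rewrite -mulmxA ZP.
have QJa : Q *m (J j *m Z) = J j *m Z by rewrite mulmxA QJ.
rewrite mul0mx add0r (trace_comm_offdiag hP PQ QE EP _ QJa JPa).
have EE : E^t* = \sum_(l < m) toC (dl l) *: (J l.+1)^t*.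
  rewrite /E adjmx_sum; apply: eq_bigr => l _; rewrite adjmxZ; congr (_ *: _).
  by apply/CrealP/complex_realP; exists (dl l).
rewrite EE mulmx_sumr mulmx_suml -sumrB mulmx_sumr mxtrace_sum Re_sum.
apply: eq_bigr => l _; rewrite -scalemxAr -scalemxAl -scalerBr -scalemxAr.
by rewrite mxtraceZ Re_mulr.
Qed.

Let chi_le j t : (j < m)%N -> 0 <= t <= 1 ->
  chi j.+1 t <= t * \sum_(l < m) dl l * spread_sum (minn r (minn j.+1 l.+1)).
Proof.
move=> jm /andP[t0 t1]; set c := \sum_(l < m) _.
have dg (x : R) : is_derive x 1 (fun y : R => y * c) c.
  apply: is_derive_eq (is_derive_mul (is_derive_id x 1) (is_derive_cst c x 1)) _.
  by rewrite mul1r mulr0 addr0.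
have /= := is_derive_le t0 (dchi j.+1) dg.
have -> : chi j.+1 0 = 0.
  (* [J j.+1 *m Z] maps the range of [P] into that of [Q], so its trace against [A 0] sees only the
     block [P *m A 0 *m Q], the adjoint of the block that vanishes by invariance. *)
  have ePA : P *m A 0 *m Q = 0.
    have : (P *m A 0 *m Q)^t* = 0.
      by rewrite adjmxM adjmxM A_herm (proj1 hP) (proj1 hQ) mulmxA.
    by move=> e; rewrite -[LHS]trmxCK e linear0 map_mx0.
  rewrite /chi -[J j.+1]QJ -ZP -!mulmxA mxtrace_mulC -!mulmxA.
  by rewrite [P *m _]mulmxA ePA !mulmx0 mxtrace0.
rewrite mul0r !subr0; apply => x _; apply: ler_sum => l _.
by apply: ler_wpM2l => //; apply: spread_piece_le; lia.
Qed.

Lemma flow_bound :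
  Re (\tr (Z *m A 1)) - Re (\tr (Z *m A 0)) <=
  \sum_(j < m) dl j * \sum_(l < m) dl l * spread_sum (minn r (minn j.+1 l.+1)).
Proof.
set c := \sum_(j < m) _.
(* The comparison function is quadratic: each [chi] is at most linear in time, so the derivative of
   the trace is at most [x *+ 2 * c]. *)
have dg (x : R) : is_derive x 1 (fun y : R => y * y * c) (x *+ 2 * c).
  have h := is_derive_mul (is_derive_id x 1) (is_derive_id x 1).
  apply: is_derive_eq (is_derive_mul h (is_derive_cst c x 1)) _.
  by rewrite mulr0 addr0 mul1r mulr1 mulr2n.
pose phi' t := (\sum_(j < m) dl j * chi j.+1 t) *+ 2.
have dphi (t : R) : is_derive t 1 (fun x => Re (\tr (Z *m A x))) (phi' t).
  have dF : mxderive (fun x => Z *m A x) t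
      (0 *m A t + Z *m (A t *m (E - E^t*) - (E - E^t*) *m A t)).
    exact: mxderiveM (mxderive_cst _ _) (dA t).
  apply: is_derive_eq (mxderive_trace dF) _.
  rewrite mul0mx add0r (trace_comm_corner hP PQ QE Zh (A_herm t) ZP).
  rewrite ReD Re_conj -mulr2n /phi'; congr (_ *+ 2).
  rewrite !mulmx_suml mxtrace_sum Re_sum; apply: eq_bigr => j _.
  by rewrite -!scalemxAl mxtraceZ Re_mulr.
have := is_derive_le ler01 dphi dg.
rewrite !mul1r !mul0r subr0; apply => t t01; have /andP[t0 t1] := t01.
rewrite /phi' mulrnAl ler_pMn2r // mulr_sumr.
apply: ler_sum => j _.
by rewrite mulrCA; apply: ler_wpM2l => //; apply: chi_le.
Qed.

End FlowBound.

(** * Block rotations and their generator *)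

Section Rotation.
Variable C : numClosedFieldType.

Definition dgmx m (a : 'I_m -> C) : 'M[C]_m := diag_mx (\row_i a i).

Lemma dgmxM m (a b : 'I_m -> C) : dgmx a *m dgmx b = dgmx (fun i => a i * b i).
Proof. by rewrite /dgmx mulmx_diag; congr diag_mx; apply/rowP => i; rewrite !mxE. Qed.

Lemma dgmxD m (a b : 'I_m -> C) : dgmx a + dgmx b = dgmx (fun i => a i + b i).
Proof. by rewrite /dgmx -raddfD; congr diag_mx; apply/rowP => i; rewrite !mxE. Qed.

Lemma dgmxN m (a : 'I_m -> C) : - dgmx a = dgmx (fun i => - a i).
Proof. by rewrite /dgmx -raddfN; congr diag_mx; apply/rowP => i; rewrite !mxE. Qed.

Lemma dgmx_adj m (a : 'I_m -> C) : (forall i, a i \is Num.real) -> (dgmx a)^t* = dgmx a.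
Proof.
move=> ra; rewrite /dgmx tr_diag_mx map_diag_mx; congr diag_mx.
by apply/rowP => i; rewrite !mxE; apply/CrealP.
Qed.

Lemma eq_dgmx m (a b : 'I_m -> C) : a =1 b -> dgmx a = dgmx b.
Proof. by move=> ab; congr diag_mx; apply/rowP => i; rewrite !mxE. Qed.

Lemma dgmx1 m : dgmx (fun _ : 'I_m => 1) = 1%:M.
Proof. by rewrite /dgmx -diag_const_mx; congr diag_mx; apply/rowP => i; rewrite !mxE. Qed.

Definition rotmx m (a b : 'I_m -> C) : 'M[C]_(m + m) :=
  block_mx (dgmx a) (- dgmx b) (dgmx b) (dgmx a).

Lemma rotmx_unitary m (a b : 'I_m -> C) :
  (forall i, a i \is Num.real) -> (forall i, b i \is Num.real) ->
  (forall i, a i ^+ 2 + b i ^+ 2 = 1) -> (rotmx a b)^t* *m rotmx a b = 1%:M.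
Proof.
move=> ra rb ab; rewrite /rotmx tr_block_mx map_block_mx mulmx_block.
rewrite adjmxN !dgmx_adj //.
rewrite !mulmxN !mulNmx opprK !dgmxM !dgmxN !dgmxD.
rewrite [RHS]scalar_mx_block -dgmx1 -(eq_dgmx ab).
by congr block_mx; apply/matrixP => i j; rewrite !mxE;
  case: (i == j); rewrite ?mulr0n ?mulr1n; ring.
Qed.

(** For an isometry [B], this acts as [r] on the range of [B] and as the identity on its orthogonal
    complement. *)
Definition plane_rot d n (B : 'M[C]_(d, n)) (r : 'M[C]_n) : 'M[C]_d :=
  1%:M + B *m (r - 1%:M) *m B^t*.

Lemma plane_rotM d n (B : 'M[C]_(d, n)) (r : 'M[C]_n) (k : 'M[C]_n) :
  B^t* *m B = 1%:M -> plane_rot B r *m (B *m k *m B^t*) = B *m (r *m k) *m B^t*.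
Proof.
move=> BB; rewrite /plane_rot mulmxDl mul1mx !mulmxA.
rewrite -[_ *m (r - 1%:M) *m B^t* *m B]mulmxA BB mulmx1.
by rewrite mulmxBr mulmx1 !mulmxBl addrC subrK.
Qed.

Lemma plane_rot_unitary d n (B : 'M[C]_(d, n)) (r : 'M[C]_n) :
  B^t* *m B = 1%:M -> r^t* *m r = 1%:M -> plane_rot B r \is unitarymx.
Proof.
move=> BB rr; rewrite -trmxC_unitary; apply/unitarymxP; rewrite trmxCK.
have -> : (plane_rot B r)^t* = plane_rot B (r^t*).
  by rewrite /plane_rot adjmxD adjmx1 !adjmxM trmxCK adjmxB adjmx1 mulmxA.
rewrite {2}/plane_rot mulmxDr mulmx1 plane_rotM // mulmxBr rr mulmx1.
rewrite /plane_rot -addrA -mulmxDl -mulmxDr [_ + (1%:M - _)]addrC subrKA subrr.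
by rewrite mulmx0 mul0mx addr0.
Qed.

(** This is the derivative at [t = 0] of the block rotation by the angles [t * a i]. *)
Definition rot_gen m (a : 'I_m -> C) : 'M[C]_(m + m) :=
  block_mx 0 (- dgmx a) (dgmx a) 0.

Lemma rot_genE d m (B1 B2 : 'M[C]_(d, m)) (a : 'I_m -> C) :
  (forall i, a i \is Num.real) ->
  let E := B2 *m dgmx a *m B1^t* in
  row_mx B1 B2 *m rot_gen a *m (row_mx B1 B2)^t* = E - E^t*.
Proof.
move=> ra E; rewrite /E !adjmxM trmxCK dgmx_adj // mulmxA /rot_gen mul_row_block.
rewrite tr_row_mx map_col_mx mul_row_col !mulmx0 add0r addr0.
by rewrite mulmxN mulNmx.
Qed.

(** When [a] and [b] are the cosines and sines of [t * th i], the right-hand side is the derivative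
    of the rotation in [t]. *)
Lemma rotmx_gen m (a b th : 'I_m -> C) :
  rotmx a b *m rot_gen th =
  block_mx (dgmx (fun i => - (th i * b i))) (- dgmx (fun i => th i * a i))
           (dgmx (fun i => th i * a i)) (dgmx (fun i => - (th i * b i))).
Proof.
rewrite /rotmx /rot_gen mulmx_block !mulmx0 !add0r !addr0 mulNmx !mulmxN !dgmxM dgmxN.
by congr block_mx; rewrite ?dgmxN; apply: eq_dgmx => i; rewrite mulrC.
Qed.

End Rotation.

(** * The rotation flow and its derivative *)

Section RotationFlow.
Variable R : realType.
Local Notation C := (R[i]).
Local Notation toC := (real_complex R).

Lemma block_mxE (T : Type) m1 m2 n1 n2 (Xa : 'M[T]_(m1, n1)) (Xb : 'M[T]_(m1, n2))
  (Xc : 'M[T]_(m2, n1)) (Xd : 'M[T]_(m2, n2)) i j :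
  block_mx Xa Xb Xc Xd i j = match fintype.split i, fintype.split j with
  | inl i', inl j' => Xa i' j' | inl i', inr j' => Xb i' j'
  | inr i', inl j' => Xc i' j' | inr i', inr j' => Xd i' j' end.
Proof. by rewrite mxE; case: (fintype.split i) => i'; rewrite mxE. Qed.

Lemma mxderive_block m1 m2 n1 n2 (Fa : R -> 'M[C]_(m1, n1)) (Fb : R -> 'M[C]_(m1, n2))
  (Fc : R -> 'M[C]_(m2, n1)) (Fd : R -> 'M[C]_(m2, n2)) t La Lb Lc Ld :
  mxderive Fa t La -> mxderive Fb t Lb -> mxderive Fc t Lc -> mxderive Fd t Ld ->
  mxderive (fun x => block_mx (Fa x) (Fb x) (Fc x) (Fd x)) t (block_mx La Lb Lc Ld).
Proof.
move=> ha hb hc hd i j; rewrite block_mxE; split.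
  under eq_fun do rewrite block_mxE.
  case: (fintype.split i) => i'; case: (fintype.split j) => j'.
  - by case: (ha i' j').
  - by case: (hb i' j').
  - by case: (hc i' j').
  - by case: (hd i' j').
under eq_fun do rewrite block_mxE.
case: (fintype.split i) => i'; case: (fintype.split j) => j'.
- by case: (ha i' j').
- by case: (hb i' j').
- by case: (hc i' j').
- by case: (hd i' j').
Qed.

Lemma mxderive_dgmx m (a da : 'I_m -> R -> R) (t : R) :
  (forall i, is_derive t 1 (a i) (da i t)) ->
  mxderive (fun x => dgmx (fun i => toC (a i x))) t (dgmx (fun i => toC (da i t))).
Proof.
move=> ha i j; rewrite !mxE; have [<-|ij] := eqVneq i j; rewrite ?mulr0n ?mulr1n; split.
- have -> : (fun x => complex.Re (dgmx (fun k => toC (a k x)) i i)) = a i.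
    by apply/funext => x; rewrite !mxE eqxx mulr1n.
  exact: ha.
- have -> : (fun x => complex.Im (dgmx (fun k => toC (a k x)) i i)) = cst 0.
    by apply/funext => x; rewrite !mxE eqxx mulr1n.
  exact: is_derive_cst.
- have -> : (fun x => complex.Re (dgmx (fun k => toC (a k x)) i j)) = cst 0.
    by apply/funext => x; rewrite !mxE (negPf ij) mulr0n.
  exact: is_derive_cst.
- have -> : (fun x => complex.Im (dgmx (fun k => toC (a k x)) i j)) = cst 0.
    by apply/funext => x; rewrite !mxE (negPf ij) mulr0n.
  exact: is_derive_cst.
Qed.

Lemma mxderive_eq m n (F : R -> 'M[C]_(m, n)) t L K :
  mxderive F t L -> L = K -> mxderive F t K.
Proof. by move=> ? <-. Qed.

Lemma mxderiveN m n (F : R -> 'M[C]_(m, n)) t L :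
  mxderive F t L -> mxderive (fun x => - F x) t (- L).
Proof.
move=> hF i j; have [f1 f2] := hF i j; rewrite mxE; case: (L i j) f1 f2 => a b f1 f2.
split.
  have -> : (fun x => complex.Re ((- F x) i j)) = (fun x => - complex.Re (F x i j)).
    by apply/funext => x; rewrite mxE; case: (F x i j).
  exact: is_deriveN.
have -> : (fun x => complex.Im ((- F x) i j)) = (fun x => - complex.Im (F x i j)).
  by apply/funext => x; rewrite mxE; case: (F x i j).
exact: is_deriveN.
Qed.

(** For an isometry [B], this is the exponential of [t] times the generator in closed form: a
    rotation by [t * th i] in the [i]-th plane. *)
Definition rot_flow d m (B : 'M[C]_(d, m + m)) (th : 'I_m -> R) (t : R) :=
  plane_rot B (rotmx (fun i => toC (cos (t * th i))) (fun i => toC (sin (t * th i)))).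

Lemma real_complex_real (a : R) : toC a \is Num.real.
Proof. by apply/complex_realP; exists a. Qed.

Lemma rot_flow_unitary d m (B : 'M[C]_(d, m + m)) th t : B^t* *m B = 1%:M ->
  rot_flow B th t \is unitarymx.
Proof.
move=> BB; apply: plane_rot_unitary BB _.
apply: rotmx_unitary => i; try exact: real_complex_real.
by rewrite -!(rmorphXn toC) -(rmorphD toC) cos2Dsin2.
Qed.

Lemma is_derive_scaled (f : R -> R) (c l t : R) : is_derive (t * c) 1 f l ->
  is_derive t 1 (fun x => f (x * c)) (c * l).
Proof.
move=> hf; have hg : is_derive t 1 (fun x : R => x * c) c.
  apply: is_derive_eq (is_derive_mul (is_derive_id t 1) (is_derive_cst c t 1)) _.
  by rewrite mul1r mulr0 addr0.
rewrite [c * l]mulrC.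
exact: (@is_derive1_comp _ f (fun x : R => x * c) t l c hf hg).
Qed.

Lemma rot_flow_derive d m (B : 'M[C]_(d, m + m)) th t : B^t* *m B = 1%:M ->
  mxderive (rot_flow B th) t
    (rot_flow B th t *m (B *m rot_gen (fun i => toC (th i)) *m B^t*)).
Proof.
move=> BB; rewrite /rot_flow plane_rotM // rotmx_gen.
pose a i (x : R) := cos (x * th i); pose b i (x : R) := sin (x * th i).
pose da i (x : R) := - (th i * b i x); pose db i (x : R) := th i * a i x.
have ha i : is_derive t 1 (a i) (da i t).
  apply: is_derive_eq (is_derive_scaled (is_derive_cos _)) _.
  by rewrite /da /b mulrN.
have hb i : is_derive t 1 (b i) (db i t).
  exact: is_derive_scaled (is_derive_sin _).
have Da := mxderive_dgmx ha; have Db := mxderive_dgmx hb.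
have D := mxderive_block Da (mxderiveN Db) Db Da.
have D1 := mxderiveD D (mxderive_cst (- 1%:M) t).
have D2 := mxderiveM (mxderiveM (mxderive_cst B t) D1) (mxderive_cst (B^t*) t).
have D3 := mxderiveD (mxderive_cst 1%:M t) D2.
apply: mxderive_eq D3 _.
rewrite add0r mulmx0 addr0 mul0mx add0r addr0.
have -> : dgmx (fun i => toC (da i t)) = dgmx (fun i => - (toC (th i) * toC (b i t))).
  by apply: eq_dgmx => i; rewrite /da rmorphN rmorphM.
have -> : dgmx (fun i => toC (db i t)) = dgmx (fun i => toC (th i) * toC (a i t)).
  by apply: eq_dgmx => i; rewrite /db rmorphM.
by [].
Qed.

(** Since [K] is skew-Hermitian, the derivative of the adjoint of [U] is [- K] times that adjoint;
    the product rule then yields a commutator. *)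
Lemma conj_flow_derive d (A K : 'M[C]_d) (U : R -> 'M[C]_d) t :
  K^t* = - K -> mxderive U t (U t *m K) ->
  mxderive (fun x => (U x)^t* *m A *m U x) t
    ((U t)^t* *m A *m U t *m K - K *m ((U t)^t* *m A *m U t)).
Proof.
move=> Kh dU.
have D := mxderiveM (mxderiveM (mxderive_adj dU) (mxderive_cst A t)) dU.
apply: mxderive_eq D _.
by rewrite adjmxM Kh mulmx0 addr0 !mulNmx !mulmxA addrC.
Qed.

End RotationFlow.

(** * Singular values and principal angles *)

Section EigenAndSingularValues.
Variable R : realType.
Local Notation C := (R[i]).
Local Notation Re := (@complex.Re R).
Local Notation toC := (real_complex R).
Local Notation ge := (fun x y : R => y <= x).

Lemma ge_trans : transitive ge.
Proof. by move=> x y z xy yz; apply: le_trans yz xy. Qed.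

Lemma ge_antisym : antisymmetric ge.
Proof. by move=> x y; rewrite andbC; apply: le_anti. Qed.

Lemma nth_sorted_ge (s : seq R) i j : sorted ge s -> (i <= j < size s)%N -> s`_j <= s`_i.
Proof.
move=> hs /andP[ij js].
by apply: (sorted_leq_nth ge_trans (@lexx _ R) 0 hs); rewrite ?inE ?(leq_ltn_trans ij js).
Qed.

Lemma codom_nth n (s : seq R) : size s = n -> codom (fun i : 'I_n => s`_i) = s.
Proof.
move=> sn; apply: (@eq_from_nth _ 0); first by rewrite size_codom card_ord.
move=> i; rewrite size_codom card_ord => iN.
by rewrite codomE (nth_map (Ordinal iN)) ?size_enum_ord // nth_enum_ord.
Qed.

Lemma perm_codom_nth n (s : seq R) (a : 'I_n -> R) : perm_eq s (codom a) ->
  exists p : {perm 'I_n}, forall i : 'I_n, s`_i = a (p i).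
Proof.
move=> hs; have : perm_eq s [tuple a i | i < n] by rewrite (perm_trans hs) // codomE.
case/tuple_permP => p sp; exists p => i.
by rewrite sp -tnth_nth !tnth_mktuple.
Qed.

(** A product of monic linear factors determines its roots up to order, so the result does not
    depend on which list of roots the definition selects. *)
Lemma eigvals_perm n (A : 'M[C]_n) (s : seq R) :
  char_poly A = \prod_(x <- s) ('X - (toC x)%:P) -> perm_eq (eigvals A) s.
Proof.
move=> hA; rewrite /eigvals perm_sort.
case: closed_field_poly_normal => u /=.
rewrite (monicP (char_poly_monic A)) scale1r hA.
rewrite -(big_map toC xpredT (fun z => 'X - z%:P)).
move=> /esym/prod_XsubC_eq /(perm_map Re).
by rewrite -map_comp (eq_map (g := id)) ?map_id.
Qed.

Lemma eigvals_sorted n (A : 'M[C]_n) : sorted ge (eigvals A).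
Proof. by apply: sort_sorted => x y; apply: le_total. Qed.

Lemma size_eigvals n (A : 'M[C]_n) : size (eigvals A) = n.
Proof.
rewrite /eigvals size_sort size_map; case: closed_field_poly_normal => u /=.
rewrite (monicP (char_poly_monic A)) scale1r => /(congr1 (fun p : {poly C} => size p)).
by rewrite size_char_poly size_prod_XsubC => -[].
Qed.

Lemma eigvals_udiag n (W : 'M[C]_n) (a : 'I_n -> R) : W \is unitarymx ->
  perm_eq (eigvals (udiag W (fun i => toC (a i)))) (codom a).
Proof.
move=> hW; apply: eigvals_perm; rewrite char_poly_udiag //.
by rewrite !big_map.
Qed.

Lemma hermsymmx_of_adj n (A : 'M[C]_n) : A^t* = A -> A \is hermsymmx.
Proof. by move=> hA; apply/is_hermitianmxP; rewrite expr0 scale1r hA. Qed.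

Lemma hermitian_udiag_real n (A : 'M[C]_n) : A^t* = A ->
  exists (W : 'M[C]_n) (a : 'I_n -> R), W \is unitarymx /\ A = udiag W (fun i => toC (a i)).
Proof.
move=> /hermsymmx_of_adj/hermitian_udiag [W [a [hW ra ->]]].
exists W, (fun i => Re (a i)); split; first exact: hW.
apply: eq_udiag => i.
by rewrite RRe_real.
Qed.

(** The spectral theorem gives the eigenvalues in an arbitrary order; permuting the rows of the
    unitary matrix matches them with the sorted list. *)
Lemma hermitian_udiag_eigvals n (A : 'M[C]_n) : A^t* = A ->
  exists W : 'M[C]_n, W \is unitarymx /\ A = udiag W (fun i => toC (eigvals A)`_i).
Proof.
move=> /hermitian_udiag_real [W [a [hW eA]]].
have [s hs] := perm_codom_nth (eigvals_udiag a hW).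
exists (row_perm s W); split; first exact: row_perm_unitary.
rewrite {1}eA -(udiag_row_perm _ _ s); apply: eq_udiag => i /=.
by rewrite eA hs.
Qed.

Lemma eigvals_between n (A : 'M[C]_n) i : A^t* = A -> psdmx A -> psdmx (1%:M - A) ->
  (i < n)%N -> 0 <= (eigvals A)`_i <= 1.
Proof.
move=> Ah A0 A1 iN; have [W [hW eA]] := hermitian_udiag_eigvals Ah.
have := psd_unitary_diag (Ordinal iN) hW A0 A1.
have -> : (W *m A *m W^t*) (Ordinal iN) (Ordinal iN) = toC (eigvals A)`_i.
  rewrite {1}eA /udiag !mulmxA (unitarymxP hW) mul1mx mulmxtVK //.
  by rewrite !mxE eqxx mulr1n.
by rewrite -(rmorph0 toC) -(rmorph1 toC) !lecR.
Qed.

Lemma size_svals p q (N : 'M[C]_(p, q)) : size (svals N) = q.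
Proof. by rewrite size_map size_eigvals. Qed.

Lemma svals_sorted p q (N : 'M[C]_(p, q)) : sorted ge (svals N).
Proof.
by rewrite sorted_map; apply: sub_sorted (eigvals_sorted _) => x y; apply: ler_wsqrtr.
Qed.

Lemma gram_adj p q (N : 'M[C]_(p, q)) : (N^t* *m N)^t* = N^t* *m N.
Proof. by rewrite adjmxM trmxCK. Qed.

Lemma svals_contraction p q (N : 'M[C]_(p, q)) i : contraction N -> (i < q)%N ->
  0 <= (svals N)`_i <= 1.
Proof.
move=> cN iq; rewrite (nth_map 0) ?size_eigvals // sqrtr_ge0 /=.
have h := contraction_adj cN; rewrite /contraction trmxCK in h.
have h0 := psdmx_gram (N^t*); rewrite trmxCK in h0.
have /andP[_ e1] := eigvals_between (gram_adj N) h0 h iq.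
by rewrite -(sqrtr1 R) ler_wsqrtr.
Qed.

Lemma svals_hermitian n (W : 'M[C]_n) (a : 'I_n -> R) : W \is unitarymx ->
  perm_eq (svals (udiag W (fun i => toC (a i)))) (codom (fun i => `|a i|)).
Proof.
move=> hW; rewrite /svals udiag_adj; last by move=> i; apply: real_complex_real.
rewrite udiagM //.
have -> : udiag W (fun i => toC (a i) * toC (a i)) = udiag W (fun i => toC (a i ^+ 2)).
  by apply: eq_udiag => i; rewrite rmorphXn.
rewrite (perm_trans (perm_map _ (eigvals_udiag _ hW))) // /codom /image_mem -map_comp.
by rewrite (eq_map (g := fun i => `|a i|)) // => i /=; rewrite sqrtr_sqr.
Qed.

(** The singular values of a Hermitian matrix are the absolute values of its eigenvalues; the
    permutation that sorts them is the one passed to [kyfan_attained]. *)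
Lemma kyfan_svals n (D : 'M[C]_n) r : D^t* = D -> (r <= n)%N ->
  exists Z : 'M[C]_n, [/\ Z^t* = Z, pisometry Z, \tr (Z *m Z^t*) <= r%:R &
    Re (\tr (Z *m D)) = \sum_(i < r) (svals D)`_i].
Proof.
move=> /hermitian_udiag_real [W [a [hW eD]]] rn.
have [s hs] := perm_codom_nth (svals_hermitian a hW).
have ra i : toC (a i) \is Num.real by apply: real_complex_real.
have [Z [Zh Zi Zr ZD]] := kyfan_attained s r hW ra.
exists Z; split=> //; rewrite eD ZD (big_ord_widen _ (fun i => (svals _)`_i) rn).
rewrite (big_morph Re (@ReD R) (erefl : Re 0 = 0)); apply: eq_bigr => i _.
by rewrite hs normc_def /= expr0n addr0 sqrtr_sqr.
Qed.

End EigenAndSingularValues.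

(** * Gram matrices of isometries and the subspaces of a direct rotation *)

Section IsometryBlocks.
Variable C : numClosedFieldType.

Lemma char_poly_block_diag n1 n2 (A : 'M[C]_n1) (D : 'M[C]_n2) :
  char_poly (block_mx A 0 0 D) = char_poly A * char_poly D.
Proof.
rewrite /char_poly /char_poly_mx map_block_mx !map_mx0 scalar_mx_block.
by rewrite opp_block_mx add_block_mx !oppr0 !addr0 det_ublock.
Qed.

Lemma adj_row_mx d n1 n2 (A : 'M[C]_(d, n1)) (B : 'M[C]_(d, n2)) :
  (row_mx A B)^t* = col_mx (A^t*) (B^t*).
Proof. by rewrite tr_row_mx map_col_mx. Qed.

Lemma gram_row_mx d n1 n2 p1 p2 (A : 'M[C]_(d, n1)) (B : 'M[C]_(d, n2))
  (A' : 'M[C]_(d, p1)) (B' : 'M[C]_(d, p2)) :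
  (row_mx A B)^t* *m row_mx A' B' =
  block_mx (A^t* *m A') (A^t* *m B') (B^t* *m A') (B^t* *m B').
Proof. by rewrite adj_row_mx mul_col_row. Qed.

Lemma isometry_pisometry d n (B : 'M[C]_(d, n)) : B^t* *m B = 1%:M -> pisometry B.
Proof. by move=> BB; rewrite /pisometry -mulmxA BB mulmx1. Qed.

Lemma isometry_compl d n (W : 'M[C]_(d, n)) : n = d -> W^t* *m W = 1%:M ->
  W *m W^t* = 1%:M.
Proof. by move=> nd; subst n; apply: mulmx1C. Qed.

Lemma submx_factor d n p (B : 'M[C]_(d, n)) (X : 'M[C]_(d, p)) :
  (B^T <= X^T)%MS -> exists G, B = X *m G.
Proof.
by case/submxP => M e; exists (M^T); rewrite -[LHS]trmxK e trmx_mul trmxK.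
Qed.

(** The inclusion gives [B = X *m G0], and the square matrix [G0] is then an isometry, hence
    unitary; its adjoint is the required [G]. *)
Lemma isometry_same_range d k (B X : 'M[C]_(d, k)) :
  B^t* *m B = 1%:M -> X^t* *m X = 1%:M -> (B^T <= X^T)%MS ->
  exists2 G : 'M[C]_k, G^t* *m G = 1%:M & X = B *m G.
Proof.
move=> BB XX /submx_factor [G0 e].
have GG : G0^t* *m G0 = 1%:M.
  by rewrite -BB e adjmxM mulmxA -[_ *m X^t* *m X]mulmxA XX mulmx1.
have GG' := mulmx1C GG.
by exists (G0^t*); rewrite ?trmxCK // e -mulmxA GG' mulmx1.
Qed.

Lemma char_poly_gram_unitary k (G M H : 'M[C]_k) : G^t* *m G = 1%:M ->
  H^t* *m H = 1%:M -> let N := G^t* *m M *m H in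
  char_poly (N^t* *m N) = char_poly (M^t* *m M).
Proof.
move=> GG HH N; rewrite /N !adjmxM trmxCK !mulmxA.
rewrite -[_ *m G *m G^t*]mulmxA (mulmx1C GG) mulmx1 -[H^t* *m _ *m _]mulmxA.
exact: char_poly_similar.
Qed.

(** [X] and [Y] differ from the adapted bases [row_mx B1 B2] and [row_mx B1 P3] by unitary factors.
    Between the adapted bases the Gram matrix is block diagonal, as [B1] is orthogonal to [B2] and
    to [P3]. *)
Lemma gram_common_part d n1 m (X Y : 'M[C]_(d, n1 + m)) (B1 : 'M[C]_(d, n1))
  (B2 P3 : 'M[C]_(d, m)) :
  X^t* *m X = 1%:M -> Y^t* *m Y = 1%:M -> B1^t* *m B1 = 1%:M ->
  B2^t* *m B2 = 1%:M -> P3^t* *m P3 = 1%:M -> B1^t* *m B2 = 0 -> B1^t* *m P3 = 0 ->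
  ((row_mx B1 B2)^T <= X^T)%MS -> ((row_mx B1 P3)^T <= Y^T)%MS ->
  let M := block_mx 1%:M 0 0 (B2^t* *m P3) : 'M[C]_(n1 + m) in
  char_poly ((X^t* *m Y)^t* *m (X^t* *m Y)) = char_poly (M^t* *m M).
Proof.
move=> XX YY B11 B22 P33 B12 B1P BX BY M.
have B21 : B2^t* *m B1 = 0.
  by rewrite -[LHS]trmxCK adjmxM trmxCK B12 trmx0 map_mx0.
have P31 : P3^t* *m B1 = 0.
  by rewrite -[LHS]trmxCK adjmxM trmxCK B1P trmx0 map_mx0.
have BB : (row_mx B1 B2)^t* *m row_mx B1 B2 = 1%:M.
  by rewrite gram_row_mx B11 B12 B21 B22 -scalar_mx_block.
have PP : (row_mx B1 P3)^t* *m row_mx B1 P3 = 1%:M.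
  by rewrite gram_row_mx B11 B1P P31 P33 -scalar_mx_block.
have [G GG eX] := isometry_same_range BB XX BX.
have [H HH eY] := isometry_same_range PP YY BY.
have -> : X^t* *m Y = G^t* *m M *m H.
  by rewrite eX eY adjmxM mulmxA -[_ *m _ *m row_mx _ _]mulmxA gram_row_mx B11 B1P B21.
exact: char_poly_gram_unitary.
Qed.

Lemma gram_contraction d m p (B : 'M[C]_(d, m)) (P : 'M[C]_(d, p)) :
  B^t* *m B = 1%:M -> P^t* *m P = 1%:M -> contraction (B^t* *m P).
Proof.
move=> BB PP; apply: contraction_mul; last exact/pisometry_contraction/isometry_pisometry.
exact/contraction_adj/pisometry_contraction/isometry_pisometry.
Qed.

Lemma perp_anti d (S T : 'M[C]_d) : (S <= T)%MS -> (kermx (T^t*) <= kermx (S^t*))%MS.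
Proof.
by case/submxP => M ->; apply/sub_kermxP; rewrite adjmxM mulmxA mulmx_ker mul0mx.
Qed.

(** The [let]s mirror those of [direct_rotation], so the inclusions apply to its subspaces by
    conversion. Those into [perp XiY] follow because [perp] reverses inclusions. *)
Lemma rotation_subspaces d (SX SY : 'M[C]_d) :
  let perp (S : 'M[C]_d) := kermx (S^t*) in
  let XiY := (SX :&: SY)%MS in
  let XiYp := (SX :&: perp SY)%MS in
  let XpiY := (perp SX :&: SY)%MS in
  let XpiYp := (perp SX :&: perp SY)%MS in
  let G := perp (XiY + XiYp + XpiY + XpiYp)%MS in
  let S1 := (XiYp + (SX :&: G))%MS in
  let S2 := (XpiY + (perp SX :&: G))%MS in
  let S3 := (XpiY + (SY :&: G))%MS in
  [/\ (S1 <= SX)%MS, (S2 <= perp SX)%MS, (S3 <= SY)%MS, (S1 <= perp XiY)%MS &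
      (S3 <= perp XiY)%MS].
Proof.
move=> perp XiY XiYp XpiY XpiYp G S1 S2 S3.
have GX : (G <= perp XiY)%MS by apply: perp_anti; rewrite -!addsmxA addsmxSl.
split; rewrite addsmx_sub ?capmxSl ?capmxSr ?(submx_trans (capmxSr _ _) GX) ?andbT //=.
  exact: submx_trans (capmxSr _ _) (perp_anti (capmxSr _ _)).
exact: submx_trans (capmxSl _ _) (perp_anti (capmxSl _ _)).
Qed.

Lemma perp_adj_mul d n p (S : 'M[C]_d) (B : 'M[C]_(d, n)) (D : 'M[C]_(d, p)) :
  (B^T <= S)%MS -> (D^T <= kermx (S^t*))%MS -> B^t* *m D = 0.
Proof.
case/submxP => M e /sub_kermxP h.
have : D^T *m (B^T)^t* = 0 by rewrite e adjmxM mulmxA h mul0mx.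
move=> /(congr1 trmx); rewrite trmx_mul trmxK trmx0 => <-.
by rewrite trmxK map_trmx.
Qed.

(** Conjugating the block form by the full orthonormal basis expands [U], and the identity expands
    as the sum of the four basis projections; the contributions of [B1] and [B4] to the two sides
    agree. *)
Lemma plane_rot_of_block d n1 m n4 (U : 'M[C]_d) (B1 : 'M[C]_(d, n1))
  (B2 B3 : 'M[C]_(d, m)) (B4 : 'M[C]_(d, n4)) (c s : 'I_m -> C) :
  let W := row_mx (row_mx (row_mx B1 B2) B3) B4 in
  W *m W^t* = 1%:M ->
  U *m W = W *m block_mx
    (block_mx (block_mx (1%:M : 'M[C]_n1) 0 0 (dgmx c)) (col_mx 0 (- dgmx s))
              (row_mx 0 (dgmx s)) (dgmx c)) 0 0 (1%:M : 'M[C]_n4) ->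
  U = plane_rot (row_mx B2 B3) (rotmx c s).
Proof.
move=> W WW UW.
have W1 : B1 *m B1^t* + B2 *m B2^t* + B3 *m B3^t* + B4 *m B4^t* = 1%:M.
  by rewrite -WW /W !adj_row_mx !mul_row_col.
rewrite -[LHS]mulmx1 -WW mulmxA UW /W !adj_row_mx !mul_row_block !mulmx0 !mulmx1.
rewrite !addr0 !add0r mul_row_col mul_mx_row mulmx0 add_row_mx !addr0.
rewrite !mul_row_col mulmx0 add0r.
rewrite /plane_rot -W1 /rotmx scalar_mx_block opp_block_mx add_block_mx !oppr0 !addr0.
rewrite adj_row_mx mul_row_block mul_row_col !mulmxBr !mulmx1 !mulmxN.
rewrite !mulmxDl !mulNmx; apply/matrixP => i j.
set a1 := B1 *m _; set a2 := B2 *m B2^t*; set a3 := B3 *m B3^t*; set a4 := B4 *m _.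
set b1 := B2 *m dgmx c *m _; set b2 := B3 *m dgmx s *m _.
set b3 := B2 *m dgmx s *m _; set b4 := B3 *m dgmx c *m _.
by clearbody a1 a2 a3 a4 b1 b2 b3 b4; rewrite !mxE; ring.
Qed.

End IsometryBlocks.

(** * Principal angles: splitting off the intersection, sign and order *)

Section PrincipalAngles.
Variable R : realType.
Local Notation C := (R[i]).
Local Notation toC := (real_complex R).
Local Notation ge := (fun x y : R => y <= x).

Lemma svals_char_poly p p' q (N : 'M[C]_(p, q)) (M : 'M[C]_(p', q)) :
  char_poly (N^t* *m N) = char_poly (M^t* *m M) -> svals N = svals M.
Proof. by move=> e; rewrite /svals /eigvals e. Qed.

(** The Gram spectrum of a direct sum is the union of the spectra; as [N] is a contraction, none of
    its singular values exceeds 1, so the ones come first in the sorted list. *)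
Lemma svals_direct_sum n1 m (N : 'M[C]_m) : contraction N ->
  svals (block_mx 1%:M 0 0 N : 'M[C]_(n1 + m)) = nseq n1 1 ++ svals N.
Proof.
move=> cN; set M := block_mx _ _ _ _.
have gM : M^t* *m M = block_mx 1%:M 0 0 (N^t* *m N).
  rewrite /M tr_block_mx map_block_mx mulmx_block adjmx1 !trmx0 !map_mx0.
  by rewrite !mulmx0 !mul0mx !mulmx1 !addr0 !add0r.
have [W [hW eN]] := hermitian_udiag_eigvals (gram_adj N).
have pM : perm_eq (eigvals (M^t* *m M)) (nseq n1 1 ++ eigvals (N^t* *m N)).
  apply: eigvals_perm; rewrite gM char_poly_block_diag big_cat /=.
  congr (_ * _).
    rewrite char_poly_trig ?scalar_mx_is_trig // big_nseq_cond.
    rewrite (eq_bigr (fun=> 'X - (1%:P))); last by move=> i _; rewrite mxE eqxx.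
    by rewrite big_const_ord.
  rewrite {1}eN char_poly_udiag // -[eigvals _ in RHS](codom_nth (size_eigvals _)).
  by rewrite !big_map.
have pS : perm_eq (svals M) (nseq n1 1 ++ svals N).
  by rewrite (perm_trans (perm_map _ pM)) // map_cat map_nseq sqrtr1.
apply: (sorted_eq (@ge_trans R) (@ge_antisym R)) pS; first exact: svals_sorted.
elim: n1 {M gM pM} => [|n1 IH] /=; first exact: svals_sorted.
rewrite path_min_sorted //; apply/allP => x; rewrite mem_cat => /orP[/nseqP[->] //|].
case/(nthP (0 : R)) => i; rewrite size_svals => im <-.
by have /andP[] := svals_contraction cN im.
Qed.

(** Directions common to both subspaces have cosine 1 and thus angle 0, and reversing the list of
    cosines moves them to the end. *)
Lemma pangles_split d n1 m (X Y : 'M[C]_(d, n1 + m)) (B1 : 'M[C]_(d, n1))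
  (B2 P3 : 'M[C]_(d, m)) :
  X^t* *m X = 1%:M -> Y^t* *m Y = 1%:M -> B1^t* *m B1 = 1%:M ->
  B2^t* *m B2 = 1%:M -> P3^t* *m P3 = 1%:M -> B1^t* *m B2 = 0 -> B1^t* *m P3 = 0 ->
  ((row_mx B1 B2)^T <= X^T)%MS -> ((row_mx B1 P3)^T <= Y^T)%MS ->
  pangles X Y = pangles B2 P3 ++ nseq n1 0.
Proof.
move=> XX YY B11 B22 P33 B12 B1P BX BY.
have cN := gram_contraction B22 P33.
have e := svals_char_poly (gram_common_part XX YY B11 B22 P33 B12 B1P BX BY).
by rewrite /pangles e (svals_direct_sum n1 cN) rev_cat rev_nseq map_cat map_nseq acos1.
Qed.

Lemma nth_pangles d m (B P : 'M[C]_(d, m)) i : (i < m)%N ->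
  (pangles B P)`_i = acos (svals (B^t* *m P))`_(m - i.+1).
Proof.
by move=> im; rewrite (nth_map 0) ?size_rev ?size_svals // nth_rev size_svals.
Qed.

Lemma size_pangles d m (B P : 'M[C]_(d, m)) : size (pangles B P) = m.
Proof. by rewrite size_map size_rev size_svals. Qed.

Lemma ler_acos (x y : R) : 0 <= x -> x <= y -> y <= 1 -> acos y <= acos x.
Proof.
move=> x0 xy y1.
have hx : -1 <= x <= 1 by lra.
have hy : -1 <= y <= 1 by lra.
have [[ax cx] [ay cy]] := (acos_def hx, acos_def hy).
rewrite leNgt -ltr_cos ?in_itv //= cx cy -leNgt //.
Qed.

Lemma pangles_ge0 d m (B P : 'M[C]_(d, m)) i : contraction (B^t* *m P) ->
  0 <= (pangles B P)`_i.
Proof.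
move=> cN; have [im|mi] := ltnP i m; last by rewrite nth_default ?size_pangles.
rewrite nth_pangles //; apply: acos_ge0.
have /andP[h0 h1] : 0 <= (svals (B^t* *m P))`_(m - i.+1) <= 1.
  by apply: svals_contraction => //; lia.
by rewrite h1 andbT; lra.
Qed.

(** Indices past the end are allowed: the default value 0 prolongs the list monotonically because
    angles are nonnegative. *)
Lemma pangles_anti d m (B P : 'M[C]_(d, m)) i j : contraction (B^t* *m P) ->
  (i <= j)%N -> (pangles B P)`_j <= (pangles B P)`_i.
Proof.
move=> cN ij; have [jm|mj] := ltnP j m; last first.
  by rewrite [X in X <= _]nth_default ?size_pangles // pangles_ge0.
rewrite !nth_pangles ?(leq_ltn_trans ij) //; apply: ler_acos.
- by have /andP[] : 0 <= (svals (B^t* *m P))`_(m - i.+1) <= 1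
    by apply: svals_contraction => //; lia.
- by apply: nth_sorted_ge; rewrite ?svals_sorted // size_svals; lia.
- by have /andP[] : 0 <= (svals (B^t* *m P))`_(m - j.+1) <= 1
    by apply: svals_contraction => //; lia.
Qed.

End PrincipalAngles.

(** * Weak submajorization and layer-cake summation *)

Section Majorization.
Variable R : realType.
Local Notation ge := (fun x y : R => y <= x).

Lemma nth_padmul (s t : seq R) i : (padmul s t)`_i = s`_i * t`_i.
Proof.
elim: s t i => [|x s IH] [|y t] [|i]; rewrite /padmul /= ?nth_nil ?mul0r ?mulr0 //.
exact: IH.
Qed.

(** Both sorts act as the identity: [x] is the longer list and receives no padding, and padding [y]
    only writes out default values of a sequence that is already non-increasing. *)
Lemma wmaj_of_sorted (x y : seq R) : (size y <= size x)%N -> sorted ge x ->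
  (forall i, 0 <= y`_i) -> (forall i j, (i <= j)%N -> y`_j <= y`_i) ->
  (forall r, (r <= size x)%N -> \sum_(i < r) x`_i <= \sum_(i < r) y`_i) -> wmaj x y.
Proof.
move=> yx sx y0 ya hxy; rewrite /wmaj (maxn_idPl yx) subnn cats0.
rewrite (sorted_sort (@ge_trans R) sx).
set y' := y ++ _.
have ny i : y'`_i = y`_i.
  by rewrite nth_cat; case: ltnP => // h; rewrite nth_nseq if_same nth_default.
rewrite (sorted_sort (@ge_trans R)); last first.
  by apply/(sortedP 0) => i _; rewrite !ny; apply: ya.
by move=> r rx; under [X in _ <= X]eq_bigr do rewrite ny; apply: hxy.
Qed.

Lemma indicator_telescope (th : nat -> R) m i : (forall j, (m <= j)%N -> th j = 0) ->
  \sum_(j < m) (i <= j)%N%:R * (th j - th j.+1) = th i.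
Proof.
move=> th0.
(* The closed form holds for every [m], which makes the induction possible; the vanishing of [th]
   beyond [m] enters only afterwards. *)
have -> : \sum_(j < m) (i <= j)%N%:R * (th j - th j.+1) = if (i <= m)%N then th i - th m else 0.
  elim: m {th0} => [|m IH].
    by rewrite big_ord0; case: i => [|i] //=; rewrite subrr.
  rewrite big_ord_recr /= IH; have [im|mi] := leqP i m.
    by rewrite leqW // mul1r addrA subrK.
  rewrite mul0r addr0; case: leqP => // im1; have -> : i = m.+1 by lia.
  by rewrite subrr.
case: leqP => [im|mi]; first by rewrite (th0 m) ?subr0.
by rewrite th0 // ltnW.
Qed.

(** An index [i < r] occurs in the innermost sum exactly when [i <= j] and [i <= l]. After
    exchanging sums, the two indicator sums telescope separately, each to [th i], whence the
    square. *)
Lemma layer_cake (th g : nat -> R) m r : (forall j, (m <= j)%N -> th j = 0) ->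
  \sum_(j < m) (th j - th j.+1) * (\sum_(l < m) (th l - th l.+1) *
     \sum_(i < minn r (minn j.+1 l.+1)) g i) = \sum_(i < r) th i ^+ 2 * g i.
Proof.
move=> th0.
have E (j l : nat) : \sum_(i < minn r (minn j.+1 l.+1)) g i =
    \sum_(i < r) ((i <= j)%N%:R * (i <= l)%N%:R * g i).
  rewrite (big_ord_widen r g (geq_minl _ _)) big_mkcond /=.
  apply: eq_bigr => i _; rewrite -natrM mulnb.
  have -> : (i < minn r (minn j.+1 l.+1))%N = (i <= j)%N && (i <= l)%N.
    by have := ltn_ord i; lia.
  by case: (_ && _); rewrite ?mul1r ?mul0r.
transitivity (\sum_(i < r) (\sum_(j < m) (i <= j)%N%:R * (th j - th j.+1)) *
   ((\sum_(l < m) (i <= l)%N%:R * (th l - th l.+1)) * g i)); last first.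
  by apply: eq_bigr => i _; rewrite !indicator_telescope // expr2 mulrA.
under [RHS]eq_bigr do rewrite mulr_suml.
rewrite [RHS]exchange_big /=; apply: eq_bigr => j _.
under eq_bigr do rewrite E mulr_sumr.
rewrite exchange_big mulr_sumr; apply: eq_bigr => i _.
rewrite mulr_suml !mulr_sumr; apply: eq_bigr => l _.
by ring.
Qed.

End Majorization.

(** * The bound for a direct rotation *)

Section RotationPieces.
Variable C : numClosedFieldType.

Lemma pid_mx_sym m j : (pid_mx j : 'M[C]_m)^t* = pid_mx j.
Proof. by rewrite tr_pid_mx map_pid_mx. Qed.

Lemma pid_mx_idem m j : (pid_mx j : 'M[C]_m) *m (pid_mx j : 'M[C]_m) = pid_mx j :> 'M[C]_m.
Proof.
apply/matrixP => i l; rewrite !mxE (bigD1 i) //= big1 => [|h /negPf hi].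
  by rewrite !mxE eqxx addr0 /= -natrM mulnb; case: (i < j)%N; rewrite ?andbF ?andbT.
by rewrite !mxE val_eqE eq_sym hi mul0r.
Qed.

Lemma trace_pid_mx_le m j : \tr (pid_mx j : 'M[C]_m) <= j%:R.
Proof.
rewrite /mxtrace (eq_bigr (fun i : 'I_m => (i < j)%N%:R)).
  by rewrite -natr_sum ler_nat sum_ltn_le.
by move=> i _; rewrite mxE eqxx.
Qed.

(** For an isometry [B2], this sends the first [j] columns of [B2] to those of [B3] and kills the
    orthogonal complement of their span. *)
Definition rot_piece d m (B2 B3 : 'M[C]_(d, m)) j := B3 *m pid_mx j *m B2^t*.

Lemma rot_piece_gram d m (B2 B3 : 'M[C]_(d, m)) j : B2^t* *m B2 = 1%:M ->
  rot_piece B2 B3 j *m (rot_piece B2 B3 j)^t* = B3 *m pid_mx j *m B3^t*.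
Proof.
move=> B22; rewrite /rot_piece !adjmxM trmxCK pid_mx_sym !mulmxA.
rewrite -[_ *m B2^t* *m B2]mulmxA B22 mulmx1.
by rewrite -[B3 *m _ *m _]mulmxA pid_mx_idem.
Qed.

Lemma rot_piece_pisometry d m (B2 B3 : 'M[C]_(d, m)) j : B2^t* *m B2 = 1%:M ->
  B3^t* *m B3 = 1%:M -> pisometry (rot_piece B2 B3 j).
Proof.
move=> B22 B33; rewrite /pisometry rot_piece_gram // /rot_piece !mulmxA.
rewrite -[_ *m B3^t* *m B3]mulmxA B33 mulmx1.
by rewrite -[B3 *m _ *m _]mulmxA pid_mx_idem.
Qed.

Lemma rot_piece_trace d m (B2 B3 : 'M[C]_(d, m)) j : B2^t* *m B2 = 1%:M ->
  B3^t* *m B3 = 1%:M -> \tr (rot_piece B2 B3 j *m (rot_piece B2 B3 j)^t*) <= j%:R.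
Proof.
move=> B22 B33; rewrite rot_piece_gram // mxtrace_mulC mulmxA B33 mul1mx.
exact: trace_pid_mx_le.
Qed.

(** The [i]-th diagonal entry collects the weights of all layers [j >= i]; when the weights are gaps
    between angles, they telescope to the [i]-th angle. *)
Lemma rot_piece_sum d m (B2 B3 : 'M[C]_(d, m)) (a : 'I_m -> C) (dl : nat -> C) :
  (forall i : 'I_m, \sum_(j < m) (i <= j)%N%:R * dl j = a i) ->
  \sum_(j < m) dl j *: rot_piece B2 B3 j.+1 = B3 *m dgmx a *m B2^t*.
Proof.
move=> ha; have -> : dgmx a = \sum_(j < m) dl j *: pid_mx j.+1.
  apply/matrixP => i l; rewrite summxE !mxE.
  have [<-|il] := eqVneq i l.
    rewrite mulr1n -ha; apply: eq_bigr => j _.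
    by rewrite !mxE eqxx /= ltnS mulrC.
  rewrite mulr0n big1 // => j _.
  by rewrite !mxE val_eqE (negPf il) mulr0.
rewrite mulmx_sumr mulmx_suml; apply: eq_bigr => j _.
by rewrite -scalemxAr -scalemxAl.
Qed.

Lemma orthoproj_range d k (X : 'M[C]_(d, k)) : X^t* *m X = 1%:M ->
  orthoproj (X *m X^t*).
Proof.
move=> XX; split; first by rewrite adjmxM trmxCK.
by rewrite !mulmxA -[X *m _ *m X]mulmxA XX mulmx1.
Qed.

(** This carries the Ky Fan maximizer from the [k]-dimensional compression to the whole space
    without changing its rank. *)
Lemma isometry_conj_herm d k (X : 'M[C]_(d, k)) (Z : 'M[C]_k) : X^t* *m X = 1%:M ->
  Z^t* = Z -> pisometry Z ->
  let Z' := X *m Z *m X^t* in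
  [/\ Z'^t* = Z', pisometry Z', Z' *m (X *m X^t*) = Z' &
      \tr (Z' *m Z'^t*) = \tr (Z *m Z^t*)].
Proof.
move=> XX Zh Zi Z'.
have Zh' : Z'^t* = Z' by rewrite /Z' !adjmxM trmxCK Zh mulmxA.
have XXr n (M : 'M[C]_(n, k)) : M *m X^t* *m X = M by rewrite -mulmxA XX mulmx1.
have ZZ : Z' *m Z' = X *m (Z *m Z) *m X^t* by rewrite /Z' !mulmxA XXr.
split=> //.
- rewrite /pisometry Zh' ZZ /Z' !mulmxA XXr.
  by move: Zi; rewrite /pisometry Zh => Zi; rewrite -!(mulmxA X) Zi.
- by rewrite /Z' mulmxA XXr.
- by rewrite Zh' ZZ mxtrace_mulC [X^t* *m (X *m _)]mulmxA XX mul1mx Zh.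
Qed.

Lemma trace_compress d k (X : 'M[C]_(d, k)) (Z : 'M[C]_k) (F G : 'M[C]_d) :
  \tr (Z *m (X^t* *m (F - G) *m X)) =
  \tr (X *m Z *m X^t* *m F) - \tr (X *m Z *m X^t* *m G).
Proof. by rewrite mulmxA mxtrace_mulC !mulmxA mulmxBr raddfB. Qed.

(** Expanding the projection onto the range of [X] in the full basis leaves only the [B1] and [B2]
    terms; comparing traces counts dimensions. *)
Lemma basis_split d k n1 m n4 (X : 'M[C]_(d, k)) (B1 : 'M[C]_(d, n1))
  (B2 B3 : 'M[C]_(d, m)) (B4 : 'M[C]_(d, n4)) :
  let W := row_mx (row_mx (row_mx B1 B2) B3) B4 in
  W *m W^t* = 1%:M -> X^t* *m X = 1%:M ->
  B1^t* *m B1 = 1%:M -> B2^t* *m B2 = 1%:M ->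
  (B1^T <= X^T)%MS -> (B2^T <= X^T)%MS -> X^t* *m B3 = 0 -> X^t* *m B4 = 0 ->
  (n1 + m)%N = k.
Proof.
move=> W WW XX B11 B22 /submx_factor[G1 e1] /submx_factor[G2 e2] X3 X4.
have W1 : B1 *m B1^t* + B2 *m B2^t* + B3 *m B3^t* + B4 *m B4^t* = 1%:M.
  by rewrite -WW /W !adj_row_mx !mul_row_col.
have PX n (G : 'M[C]_(k, n)) : X *m X^t* *m (X *m G) = X *m G.
  by rewrite mulmxA -[X *m _ *m X]mulmxA XX mulmx1.
have eP : X *m X^t* = B1 *m B1^t* + B2 *m B2^t*.
  rewrite -[LHS]mulmx1 -W1 !mulmxDr -!mulmxA [X^t* *m (B3 *m _)]mulmxA X3.
  rewrite [X^t* *m (B4 *m _)]mulmxA X4 !mul0mx !mulmx0 !addr0.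
  by rewrite !mulmxA -[X *m _ *m B1]mulmxA {1}e1 -[X *m _ *m B2]mulmxA {1}e2;
    rewrite !(mulmxA X) !PX -e1 -e2.
have := congr1 mxtrace eP.
rewrite mxtraceD [LHS]mxtrace_mulC XX [\tr (B1 *m _)]mxtrace_mulC B11.
rewrite [\tr (B2 *m _)]mxtrace_mulC B22 !mxtrace1 -natrD.
by move/eqP; rewrite eqr_nat => /eqP.
Qed.

End RotationPieces.

Section RotationBound.
Variable R : realType.
Local Notation C := (R[i]).
Local Notation Re := (@complex.Re R).
Local Notation toC := (real_complex R).

Lemma svalsN p q (N : 'M[C]_(p, q)) : svals (- N) = svals N.
Proof. by apply: svals_char_poly; rewrite adjmxN mulNmx mulmxN opprK. Qed.

Lemma rot_flow0 d m (B : 'M[C]_(d, m + m)) th : rot_flow B th 0 = 1%:M.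
Proof.
rewrite /rot_flow /rotmx.
rewrite (eq_dgmx (b := fun=> 1)); last by move=> i; rewrite mul0r cos0.
rewrite (eq_dgmx (b := fun=> 0) (a := fun i => toC (sin _))); last first.
  by move=> i; rewrite mul0r sin0.
have -> : dgmx (fun _ : 'I_m => 0) = 0 :> 'M[C]_m.
  by apply/matrixP => i j; rewrite !mxE mul0rn.
by rewrite oppr0 dgmx1 -scalar_mx_block /plane_rot subrr mulmx0 mul0mx addr0.
Qed.

(** Raw eigenvalue differences replace the spread vector here: from index [m] on, and [m] is at most
    [d./2], they are multiplied by vanishing angles. Invariance appears as [A *m X = X *m M]. *)
Lemma rotation_bound d k m (A U : 'M[C]_d) (X : 'M[C]_(d, k)) (M : 'M[C]_k)
  (B2 B3 : 'M[C]_(d, m)) (th : nat -> R) r :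
  A^t* = A -> X^t* *m X = 1%:M -> A *m X = X *m M ->
  B2^t* *m B2 = 1%:M -> B3^t* *m B3 = 1%:M -> (B2^T <= X^T)%MS -> X^t* *m B3 = 0 ->
  (m.*2 <= d)%N -> (forall j, th j.+1 <= th j) -> (forall j, (m <= j)%N -> th j = 0) ->
  (r <= k)%N ->
  U = plane_rot (row_mx B2 B3)
        (rotmx (fun i => toC (cos (th i))) (fun i => toC (sin (th i)))) ->
  \sum_(i < r) (svals (X^t* *m A *m X - (U *m X)^t* *m A *m (U *m X)))`_i <=
  \sum_(i < r) th i ^+ 2 * ((eigvals A)`_i - (eigvals A)`_(d.-1 - i)).
Proof.
move=> Ah XX AX B22 B33 /submx_factor[G eG] X3 md tha th0 rk eU.
have B23 : B2^t* *m B3 = 0 by rewrite eG adjmxM -mulmxA X3 mulmx0.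
have B32 : B3^t* *m B2 = 0.
  by rewrite -[LHS]trmxCK adjmxM trmxCK B23 trmx0 map_mx0.
set B := row_mx B2 B3.
have BB : B^t* *m B = 1%:M.
  by rewrite gram_row_mx B22 B23 B32 B33 -scalar_mx_block.
set P := X *m X^t*; set Q := 1%:M - P.
have hP : orthoproj P by apply: orthoproj_range.
have hQ : orthoproj Q by apply: orthoproj_compl.
have PQ : P + Q = 1%:M by rewrite addrC subrK.
have QB3 : Q *m B3 = B3 by rewrite mulmxBl mul1mx -mulmxA X3 mulmx0 subr0.
have B2P : B2^t* *m P = B2^t*.
  by rewrite /P eG adjmxM mulmxA -[_ *m X^t* *m X]mulmxA XX mulmx1.
pose J := rot_piece B2 B3.
have QJ j : Q *m J j = J j by rewrite /J /rot_piece !mulmxA QB3.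
have JP j : J j *m P = J j by rewrite /J /rot_piece -mulmxA B2P.
have Ji j : pisometry (J j) by apply: rot_piece_pisometry.
have Jr j : \tr (J j *m (J j)^t*) <= j%:R by apply: rot_piece_trace.
pose thm (i : 'I_m) := th i.
pose Ut t := rot_flow B thm t; pose At t := (Ut t)^t* *m A *m Ut t.
have [W0 [hW0 eA]] := hermitian_udiag_eigvals Ah.
have hU t : Ut t \is unitarymx by apply: rot_flow_unitary.
have hW t : W0 *m Ut t \is unitarymx by exact: mul_unitarymx hW0 (hU t).
have AW t : At t = udiag (W0 *m Ut t) (fun i => toC (eigvals A)`_i).
  by rewrite /At {1}eA udiag_unitary_mul.
pose dl j := th j - th j.+1.
have dl0 j : 0 <= dl j by rewrite subr_ge0.
have eE : \sum_(j < m) toC (dl j) *: J j.+1 = B3 *m dgmx (fun i => toC (thm i)) *m B2^t*.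
  apply: (@rot_piece_sum _ _ _ B2 B3 (fun i => toC (thm i)) (fun j => toC (dl j))) => i.
  rewrite /thm -(indicator_telescope i th0) rmorph_sum; apply: eq_bigr => j _.
  by rewrite rmorphM rmorph_nat.
have eK := @rot_genE _ d m B2 B3 (fun i => toC (thm i)) (fun i => real_complex_real (thm i)).
pose E := \sum_(j < m) toC (dl j) *: J j.+1.
have {}eK : B *m rot_gen (fun i => toC (thm i)) *m B^t* = E - E^t*.
  by rewrite /E eE; exact: eK.
have Kh : (E - E^t*)^t* = - (E - E^t*) by rewrite adjmxB trmxCK opprB.
have dA t : mxderive At t (At t *m (E - E^t*) - (E - E^t*) *m At t).
  apply: conj_flow_derive => //.
  by have := rot_flow_derive thm t BB; rewrite eK.
have U0 : Ut 0 = 1%:M by apply: rot_flow0.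
have A0 : At 0 = A by rewrite /At U0 adjmx1 mul1mx mulmx1.
have QAP : Q *m At 0 *m P = 0.
  rewrite A0 /P -mulmxA [A *m _]mulmxA AX mulmxA mulmxA.
  have -> : Q *m X = 0 by rewrite mulmxBl mul1mx -mulmxA XX mulmx1 subrr.
  by rewrite !mul0mx.
have U1 : Ut 1 = U.
  rewrite eU /Ut /rot_flow /rotmx; congr plane_rot.
  by rewrite !(eq_dgmx (b := fun i => toC (cos (th i))) (a := fun i => toC (cos _)))
    ?(eq_dgmx (b := fun i => toC (sin (th i))) (a := fun i => toC (sin _))) // => i;
    rewrite mul1r.
set D := _ - _.
(* The flow starts at [A] and ends at the conjugated matrix, so the difference occurs with the
   opposite sign, to which singular values are insensitive. *)
have eD : - D = X^t* *m (At 1 - At 0) *m X.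
  by rewrite A0 /At U1 mulmxBr mulmxBl /D opprB adjmxM !mulmxA.
have Dh : (- D)^t* = - D.
  by rewrite eD !adjmxM trmxCK adjmxB A0 Ah /At !adjmxM trmxCK Ah !mulmxA.
have [Z0 [Z0h Z0i Z0r Z0D]] := kyfan_svals Dh rk.
have [Zh Zi ZP Zt] := isometry_conj_herm XX Z0h Z0i.
rewrite -Zt in Z0r.
have lam_anti i j : (i <= j < d)%N -> (eigvals A)`_j <= (eigvals A)`_i.
  by move=> ij; apply: nth_sorted_ge; rewrite ?eigvals_sorted // size_eigvals.
have := flow_bound lam_anti dl0 md hP hQ PQ Zh Zi ZP Z0r QJ JP Ji Jr hW AW dA QAP.
rewrite -(layer_cake (fun i => (eigvals A)`_i - (eigvals A)`_(d.-1 - i)%N) r th0).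
apply: le_trans.
rewrite svalsN in Z0D; rewrite -Z0D eD.
by rewrite trace_compress ReD ReN.
Qed.

End RotationBound.

(** * Entries of the spread vector and of squared lists *)

Section SpreadVectors.
Variable R : realType.
Local Notation C := (R[i]).

Lemma isometryE d k (X : 'M[C]_(d, k)) : is_isometry X -> X^t* *m X = 1%:M.
Proof. by move/unitarymxP; rewrite trmxCK. Qed.

Lemma nth_sprplus d (A : 'M[C]_d) i : (i < d./2)%N ->
  (sprplus A)`_i = (eigvals A)`_i - (eigvals A)`_(d.-1 - i).
Proof. by move=> h; rewrite (nth_map 0%N) ?size_iota // nth_iota. Qed.

Lemma nth_sprplus_default d (A : 'M[C]_d) i : (d./2 <= i)%N -> (sprplus A)`_i = 0.
Proof. by move=> h; rewrite nth_default // size_map size_iota. Qed.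

Lemma sprplus_ge0 d (A : 'M[C]_d) i : 0 <= (sprplus A)`_i.
Proof.
have [h|h] := ltnP i d./2; last by rewrite nth_sprplus_default.
rewrite nth_sprplus // subr_ge0 nth_sorted_ge ?eigvals_sorted // size_eigvals.
by lia.
Qed.

Lemma sprplus_anti d (A : 'M[C]_d) i j : (i <= j)%N -> (sprplus A)`_j <= (sprplus A)`_i.
Proof.
move=> ij; have [h|h] := ltnP j d./2; last first.
  by rewrite nth_sprplus_default // sprplus_ge0.
rewrite !nth_sprplus ?(leq_ltn_trans ij) //; apply: lerB;
  by rewrite nth_sorted_ge ?eigvals_sorted // size_eigvals; lia.
Qed.

Lemma nth_sqr (s : seq R) i : [seq t ^+ 2 | t <- s]`_i = s`_i ^+ 2.
Proof.
have [h|h] := ltnP i (size s); first by rewrite (nth_map 0).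
by rewrite !nth_default ?size_map ?expr0n.
Qed.

End SpreadVectors.

Theorem theorem3p2 (R : realType) (d k : nat)
  (A SX SY U : 'M[R[i]]_d) (X Y : 'M[R[i]]_(d, k)) :
  A \is hermsymmx ->
  \rank SX = k -> \rank SY = k ->
  mx_invariant A SX ->
  U \is unitarymx -> direct_rotation SX SY U ->
  is_isometry X -> (mx_range X == SX)%MS ->
  is_isometry Y -> (mx_range Y == SY)%MS ->
  let Yr := U *m X in
  wmaj (svals (X ^t* *m A *m X - Yr ^t* *m A *m Yr))
       (padmul [seq t ^+ 2 | t <- pangles X Y] (sprplus A)).
Proof.
move=> hA _ _ inv _ dr /isometryE XX /andP[XS SX'] /isometryE YY /andP[YS SY'] Yr.
case: dr => n1 [m [n4 [B1 [B2 [B3 [B4 [P3 [[]]]]]]]]].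
move=> [/isometryE B11 /andP[B1S _]] [/isometryE B22 /andP[B2S _]].
move=> [/isometryE B33 /andP[B3S _]] [/isometryE B44 /andP[B4S _]].
move=> [[/isometryE P33 /andP[P3S _]] dims /isometryE WW UW].
have Ah : A^t* = A.
  by move/is_hermitianmxP: hA; rewrite expr0 scale1r => {2}->.
have WW' := isometry_compl dims WW.
have [S1X S2X S3Y S1p S3p] := rotation_subspaces SX SY.
have B1X := submx_trans B1S (capmxSl _ _).
have B1Y := submx_trans B1S (capmxSr _ _).
have B2X := submx_trans B2S S1X.
have P3Y := submx_trans P3S S3Y.
have X3 : X^t* *m B3 = 0 := perp_adj_mul XS (submx_trans B3S S2X).
have X4 : X^t* *m B4 = 0 := perp_adj_mul XS (submx_trans B4S (capmxSl _ _)).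
have B12 : B1^t* *m B2 = 0 := perp_adj_mul B1S (submx_trans B2S S1p).
have B1P : B1^t* *m P3 = 0 := perp_adj_mul B1S (submx_trans P3S S3p).
(* The cosines and sines left open here are read off from [UW] by unification. *)
have eU := plane_rot_of_block (c := fun j => _) (s := fun j => _) WW' UW.
have nk := basis_split WW' XX B11 B22 (submx_trans B1X SX') (submx_trans B2X SX') X3 X4.
(* [X] and [Y] now have [n1 + m] columns by type, as the comparison with the juxtaposed bases
   requires. *)
subst k.
have BX : ((row_mx B1 B2)^T <= X^T)%MS.
  by rewrite tr_row_mx col_mx_sub (submx_trans B1X SX') (submx_trans B2X SX').
have BY : ((row_mx B1 P3)^T <= Y^T)%MS.
  by rewrite tr_row_mx col_mx_sub (submx_trans B1Y SY') (submx_trans P3Y SY').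
have pXY := pangles_split XX YY B11 B22 P33 B12 B1P BX BY.
have cN := gram_contraction B22 P33.
(* The angles of the full subspaces and those of [S1] and [S3] differ only by trailing zeros, which
   coincide with the default of [nth]. *)
have nXY i : (pangles X Y)`_i = (pangles B2 P3)`_i.
  rewrite pXY nth_cat size_pangles; case: ltnP => // mi.
  by rewrite nth_nseq if_same nth_default // size_pangles.
have [M AX] : exists M, A *m X = X *m M.
  apply: submx_factor; rewrite trmx_mul.
  by apply: submx_trans SX'; apply: submx_trans inv; apply: submxMr.
have md : (m.*2 <= d)%N by clear -dims; lia.
apply: wmaj_of_sorted.
- rewrite size_map size_zip size_svals; apply: leq_trans (geq_minl _ _) _.
  by rewrite size_map size_pangles.
- exact: svals_sorted.
- by move=> i; rewrite nth_padmul nth_sqr mulr_ge0 ?sqr_ge0 ?sprplus_ge0.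
- move=> i j ij; rewrite !nth_padmul !nth_sqr !nXY.
  by rewrite ler_pM ?sqr_ge0 ?sprplus_ge0 ?sprplus_anti ?lerXn2r ?nnegrE ?pangles_ge0
    ?pangles_anti.
move=> r; rewrite size_svals => rk.
apply: le_trans (rotation_bound Ah XX AX B22 B33 (submx_trans B2X SX') X3 md _ _ rk eU) _.
- by move=> j; apply: pangles_anti.
- by move=> j mj; rewrite nth_default // size_pangles.
apply: ler_sum => i _; rewrite nth_padmul nth_sqr nXY.
(* Below [m], hence below [d./2], the entry of [sprplus] is a genuine eigenvalue difference; from
   [m] on, the angle is the default 0 and both sides vanish. *)
have [im|mi] := ltnP i m.
  rewrite nth_sprplus; first exact: lexx.
  by clear -im md; lia.
by rewrite nth_default ?size_pangles // expr0n !mul0r.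
Qed.
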